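(* There is a dynamic-programming algorithm that, given an alphabet $C$ of $n$ characters with frequencies, a blocking scheme, a permitted code length $\mathcal{L}$ and $\epsilon>0$, returns a prefix tree $T$ with $\mathrm{len}(T)\le(1+\epsilon)\mathcal{L}$ and $\Delta(T)\le \mathrm{DOPT}(\mathcal{L})$, and runs in time $O(n^4/\epsilon)$.
   Context: Let $C$ be an alphabet of $n$ characters, each $c\in C$ with a nonnegative integer frequency $\mathrm{freq}(c)$. A prefix tree for $C$ is a rooted binary tree in which every internal node has exactly two children and whose leaves are in bijection with $C$; $d_T(c)$ is the depth of the leaf of $c$ (root has depth $0$). The code length of $T$ is $\mathrm{len}(T)=\sum_{c\in C}\mathrm{freq}(c)\, d_T(c)$. A blocking scheme is a sequence $\langle (w_1,q_1),(w_2,q_2),\dots\rangle$ of positive integer widths $w_j$ and access costs $q_j\ge 0$ (assumed long enough that the quantities below exist). For a character $c$, let $W_T(c)$ be the smallest $h$ with $\sum_{j=1}^h w_j\ge d_T(c)$, and $\Delta_T(c)=\sum_{i\le W_T(c)} q_i$. The decode time of $T$ is $\Delta(T)=\sum_{c\in C}\mathrm{freq}(c)\,\Delta_T(c)$. $\mathrm{DOPT}(\mathcal{L})$ denotes the minimum of $\Delta(T)$ over all prefix trees $T$ with $\mathrm{len}(T)\le\mathcal{L}$.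
   Formalization: The running time is stated as O(n^4/min(1,ε)), since O(n^4/ε) cannot hold uniformly for very large ε (the tree must be written); the guarantees on T are asserted when some prefix tree has len ≤ L, so that DOPT(L) exists; n ≥ 1. *)

(* Defs.v *)
From HB Require Import structures.
From mathcomp Require Import all_boot all_order all_algebra.
From mathcomp Require Import reals.

Set Implicit Arguments.
Unset Strict Implicit.
Unset Printing Implicit Defensive.

Import Order.TTheory GRing.Theory Num.Theory.

Local Open Scope ring_scope.

Inductive btree (C : Type) : Type :=
| Leaf of C
| Node of btree C & btree C.

Fixpoint leaves (C : Type) (T : btree C) : seq C :=
  match T with
  | Leaf c => [:: c]
  | Node l r => leaves l ++ leaves r
  end.

Definition prefix_tree (C : finType) (T : btree C) : Prop :=
  perm_eq (leaves T) (enum C).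

(* Meaningful when c labels a leaf of T (junk value otherwise). *)
Fixpoint depth (C : eqType) (T : btree C) (c : C) : nat :=
  match T with
  | Leaf _ => 0%N
  | Node l r => if c \in leaves l then (depth l c).+1 else (depth r c).+1
  end.

Definition len (C : finType) (freq : C -> nat) (T : btree C) : nat :=
  (\sum_(c : C) freq c * depth T c)%N.

Section Blocking.
Variable R : realType.

(* A finite blocking scheme [:: (w_1, q_1); (w_2, q_2); ...]. *)
Definition scheme := seq (nat * R).

Definition valid_scheme (s : scheme) : Prop :=
  forall p, p \in s -> (0 < p.1)%N /\ 0 <= p.2.

Definition width_upto (s : scheme) (h : nat) : nat :=
  (\sum_(p <- take h s) p.1)%N.

(* "Long enough": W_T(c) exists for every prefix tree T and character c. *)
Definition long_enough (C : finType) (s : scheme) : Prop :=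
  forall T : btree C, prefix_tree T -> forall c : C,
    exists2 h, (h <= size s)%N & (depth T c <= width_upto s h)%N.

(* W_T(c): the least h <= size s whose first h widths add up to at least
   depth T c, and (size s).+1 if there is none. *)
Definition nblocks (C : eqType) (s : scheme) (T : btree C) (c : C) : nat :=
  find (fun h => depth T c <= width_upto s h)%N (iota 0 (size s).+1).

Definition char_decode_time (C : eqType) (s : scheme) (T : btree C) (c : C)
    : R :=
  \sum_(p <- take (nblocks s T c) s) p.2.

Definition decode_time (C : finType) (freq : C -> nat) (s : scheme)
    (T : btree C) : R :=
  \sum_(c : C) (freq c)%:R * char_decode_time s T c.

Definition admissible (C : finType) (freq : C -> nat) (L : R) (T : btree C)
    : Prop :=
  prefix_tree T /\ (len freq T)%:R <= L.

(* v = DOPT(L): the minimum of an empty family does not exist, so no v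
   qualifies when no prefix tree has code length at most L. *)
Definition is_DOPT (C : finType) (freq : C -> nat) (s : scheme) (L v : R)
    : Prop :=
  (exists2 T, admissible freq L T & decode_time freq s T = v) /\
  (forall T, admissible freq L T -> v <= decode_time freq s T).

End Blocking.

(* Machine model: a real RAM in structured form.  The memory consists of
   arrays of natural numbers and arrays of reals, with indirect indexing; the
   array name is a literal of the program text, so a program uses finitely
   many arrays.  Every syntax node evaluated costs one time unit.  Two
   operations are left out on purpose because at unit cost they would make the
   model unreasonably powerful: multiplication on naturals, and any conversion
   from reals to naturals (floor).  No real constants are available besides the
   casts of naturals. *)

Inductive nexp :=
| NLit of nat
| NGet of nat & nexp
| NAdd of nexp & nexp
| NSub of nexp & nexp.

Inductive rexp :=
| RNat of nexp
| RGet of nat & nexp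
| RAdd of rexp & rexp
| RSub of rexp & rexp
| RMul of rexp & rexp
| RDiv of rexp & rexp.

Inductive bexp :=
| BLeN of nexp & nexp
| BLeR of rexp & rexp
| BNot of bexp
| BAnd of bexp & bexp.

Inductive cmd :=
| Skip
| NSet of nat & nexp & nexp
| RSet of nat & nexp & rexp
| Seq of cmd & cmd
| If of bexp & cmd & cmd
| While of bexp & cmd.

Fixpoint ncost (e : nexp) : nat :=
  match e with
  | NLit _ => 1
  | NGet _ i => (ncost i).+1
  | NAdd e1 e2 | NSub e1 e2 => (ncost e1 + ncost e2).+1
  end.

Fixpoint rcost (e : rexp) : nat :=
  match e with
  | RNat e1 => (ncost e1).+1
  | RGet _ i => (ncost i).+1
  | RAdd e1 e2 | RSub e1 e2 | RMul e1 e2 | RDiv e1 e2 =>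
      (rcost e1 + rcost e2).+1
  end.

Fixpoint bcost (b : bexp) : nat :=
  match b with
  | BLeN e1 e2 => (ncost e1 + ncost e2).+1
  | BLeR e1 e2 => (rcost e1 + rcost e2).+1
  | BNot b1 => (bcost b1).+1
  | BAnd b1 b2 => (bcost b1 + bcost b2).+1
  end.

Section Semantics.
Variable R : realType.

Record state := State {
  nmem : nat -> nat -> nat;
  rmem : nat -> nat -> R
}.

Definition upd (V : Type) (M : nat -> nat -> V) (a i : nat) (v : V) :=
  fun a' i' => if (a' == a) && (i' == i) then v else M a' i'.

Fixpoint neval (s : state) (e : nexp) : nat :=
  match e with
  | NLit k => k
  | NGet a i => nmem s a (neval s i)
  | NAdd e1 e2 => (neval s e1 + neval s e2)%N
  | NSub e1 e2 => (neval s e1 - neval s e2)%N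
  end.

Fixpoint reval (s : state) (e : rexp) : R :=
  match e with
  | RNat e1 => (neval s e1)%:R
  | RGet a i => rmem s a (neval s i)
  | RAdd e1 e2 => reval s e1 + reval s e2
  | RSub e1 e2 => reval s e1 - reval s e2
  | RMul e1 e2 => reval s e1 * reval s e2
  | RDiv e1 e2 => reval s e1 / reval s e2
  end.

Fixpoint beval (s : state) (b : bexp) : bool :=
  match b with
  | BLeN e1 e2 => (neval s e1 <= neval s e2)%N
  | BLeR e1 e2 => reval s e1 <= reval s e2
  | BNot b1 => ~~ beval s b1
  | BAnd b1 b2 => beval s b1 && beval s b2
  end.

(* exec c s t s' : started in s, the command c halts in s' after time t. *)
Inductive exec : cmd -> state -> nat -> state -> Prop :=
| ExSkip s : exec Skip s 1 s
| ExNSet a i e s :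
    exec (NSet a i e) s (ncost i + ncost e).+1
      (State (upd (nmem s) a (neval s i) (neval s e)) (rmem s))
| ExRSet a i e s :
    exec (RSet a i e) s (ncost i + rcost e).+1
      (State (nmem s) (upd (rmem s) a (neval s i) (reval s e)))
| ExSeq c1 c2 s1 s2 s3 t1 t2 :
    exec c1 s1 t1 s2 -> exec c2 s2 t2 s3 -> exec (Seq c1 c2) s1 (t1 + t2) s3
| ExIfTrue b c1 c2 s1 s2 t :
    beval s1 b -> exec c1 s1 t s2 -> exec (If b c1 c2) s1 (bcost b + t).+1 s2
| ExIfFalse b c1 c2 s1 s2 t :
    ~~ beval s1 b -> exec c2 s1 t s2 ->
    exec (If b c1 c2) s1 (bcost b + t).+1 s2
| ExWhileFalse b c s :
    ~~ beval s b -> exec (While b c) s (bcost b).+1 s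
| ExWhileTrue b c s1 s2 s3 t1 t2 :
    beval s1 b -> exec c s1 t1 s2 -> exec (While b c) s2 t2 s3 ->
    exec (While b c) s1 (bcost b + t1 + t2).+1 s3.

(* The alphabet is presented to the machine as 0, ..., n-1.  Natural arrays:
   0 holds n and the number of blocks, 1 the frequencies, 2 the widths.  Real
   arrays: 0 holds L and eps, 1 the access costs.  All other cells are 0. *)
Definition input (n : nat) (freq : 'I_n -> nat) (bs : scheme R) (L eps : R)
    : state :=
  State
    (fun a i => match a with
                | 0 => nth 0%N [:: n; size bs] i
                | 1 => nth 0%N [seq freq c | c <- enum 'I_n] i
                | 2 => nth 0%N (unzip1 bs) i
                | _ => 0%N
                end)
    (fun a i => match a with
                | 0 => nth 0 [:: L; eps] i
                | 1 => nth 0 (unzip2 bs) i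
                | _ => 0
                end).

(* Pointer representation of a tree in a heap M: a leaf is a record
   (0, character), an internal node a record (1, left, right). *)
Fixpoint stored (n : nat) (M : nat -> nat) (p : nat) (T : btree 'I_n) : Prop :=
  match T with
  | Leaf c => M p = 0%N /\ M p.+1 = c
  | Node l r => [/\ M p = 1%N, stored M (M p.+1) l & stored M (M p.+2) r]
  end.

(* The output tree lives in natural array 4; cell 0 of natural array 3 holds
   the address of its root. *)
Definition output (n : nat) (s : state) (T : btree 'I_n) : Prop :=
  stored (nmem s 4) (nmem s 3 0) T.

End Semantics.

(* Main.v *)
Require Import Defs.
From HB Require Import structures.
From mathcomp Require Import all_boot all_order all_algebra.
From mathcomp Require Import reals boolp.
From mathcomp Require Import ring lra zify.

Set Implicit Arguments.
Unset Strict Implicit.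
Unset Printing Implicit Defensive.

Import Order.TTheory GRing.Theory Num.Theory.

Local Open Scope ring_scope.

(** The code length and the decode time of a tree are both sums over its levels:
    descending from depth d to d+1 costs 1, respectively the price of a possible
    new block, times the total frequency of the characters below depth d.  That
    total is at least S(v), the sum of the v smallest frequencies, where v is
    the number of characters below depth d, and a tree with the same profile
    attains S(v) on every level.  So an optimal profile is found by dynamic
    programming over (depth, characters left, nodes on the level, remaining
    code length), placing characters in order of decreasing frequency; each
    state has two successors: make the next node of the level a leaf, or turn
    all its remaining nodes into internal nodes.

    A tree has fewer than n levels, hence rounding every S(v) up to a multiple
    of delta = eps L / n inflates the code length by at most n delta = eps L.
    In units of delta the budget is floor(n/eps) + n, so there are
    O(n^3 (n/eps + n)) states. *)

(** For a fixed profile the two objectives do not compete: both are sums of level totals with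
    nonnegative coefficients, so one assignment of the characters minimises both. Rounding affects
    only the code length; decode costs stay exact reals. A tree attaining the optimum has a rounded
    length within the budget, so its profile is among those minimised over, and nothing is lost in
    decode time. Deciding one node at a time, instead of the number of leaves of a whole level,
    keeps the work per state constant. The machine shapes the second half: it has neither a product
    of naturals nor a floor, so [floor(n/eps)], the rounded sums and the strides of the table come
    from counting and repeated addition, all within the time that the table needs anyway. *)

Lemma sum_uniq_ge (h : nat -> nat) (N : nat) (s : seq nat) :
  {homo h : x y / (x <= y)%N} -> uniq s -> all (fun x => x < N)%N s ->
  (\sum_(i < size s) h i <= \sum_(i <- s) h i)%N.
Proof.
move=> hh; elim: N s => [|N IH] s us /allP als.
  case: s us als => [|x s] _ als; first by rewrite big_ord0.
  by have := als x (mem_head _ _).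
case: (boolP (N \in s)) => Ns; last first.
  apply: IH => //; apply/allP => x xs; have := als x xs.
  by rewrite ltnS leq_eqVlt; case/orP => // /eqP xN; rewrite -xN xs in Ns.
have als' : all (fun x => x < N)%N (rem N s).
  apply/allP => x; rewrite mem_rem_uniq // inE => /andP[xN /als].
  by rewrite ltnS leq_eqVlt (negPf xN).
have us' := rem_uniq N us.
(* The largest entry [N] is matched with the last term: the other entries are distinct and below
   [N], so there are at most [N] of them. *)
rewrite (perm_big _ (perm_to_rem Ns)) (perm_size (perm_to_rem Ns)) big_cons /=.
rewrite big_ord_recr /= addnC leq_add ?IH // hh //.
have := uniq_leq_size us' (_ : {subset rem N s <= iota 0 N}).
by rewrite size_iota; apply => x /(allP als'); rewrite mem_iota.
Qed.

(** * Level sums of forests *)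

Section Trees.
Variables (R : realType) (n : nat) (f : 'I_n -> nat).
Implicit Types (T : btree 'I_n) (F : seq (btree 'I_n)) (phi : nat -> R).

(** Common form of both objectives: [phi] is the identity for the code length and [block_cost] for
    the decode time; [d] is the depth of the root. *)
Fixpoint tree_weight phi d T : R :=
  match T with
  | Leaf c => (f c)%:R * phi d
  | Node l r => tree_weight phi d.+1 l + tree_weight phi d.+1 r
  end.

Lemma tree_weightE phi d T : uniq (leaves T) ->
  tree_weight phi d T =
  \sum_(c <- leaves T) (f c)%:R * phi (d + depth T c)%N.
Proof.
elim: T d => [c|l IHl r IHr] d /=; first by rewrite big_seq1 addn0.
rewrite cat_uniq big_cat => /and3P[ul /hasPn lr ur] /=.
rewrite IHl // IHr //; congr (_ + _); apply: eq_big_seq => c cl.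
  by rewrite cl addSnnS.
by rewrite (negPf (lr c cl)) addSnnS.
Qed.

Lemma prefix_tree_weight phi T : prefix_tree T ->
  \sum_(c : 'I_n) (f c)%:R * phi (depth T c) = tree_weight phi 0 T.
Proof.
move=> pT; rewrite tree_weightE; last by rewrite (perm_uniq pT) enum_uniq.
by rewrite (perm_big _ pT) big_enum.
Qed.

Definition forest_weight phi d F : R := \sum_(T <- F) tree_weight phi d T.
Definition forest_leaves F : seq 'I_n := flatten (map (@leaves _) F).
Definition forest_freq F : nat := (\sum_(c <- forest_leaves F) f c)%N.
(** A forest stands for the nodes on one level of a tree, and its children for the next level;
    leaves drop out. *)
Definition children F : seq (btree 'I_n) :=
  flatten [seq if T is Node l r then [:: l; r] else [::] | T <- F].
Definition is_leaf T := if T is Leaf _ then true else false.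

Lemma leaves_gt0 T : (0 < size (leaves T))%N.
Proof. by elim: T => //= l IHl r IHr; rewrite size_cat addn_gt0 IHl. Qed.

Lemma forest_leaves_cons T F :
  forest_leaves (T :: F) = leaves T ++ forest_leaves F.
Proof. by []. Qed.

Lemma size_forest_leaves F : (size F <= size (forest_leaves F))%N.
Proof.
elim: F => //= T F IH; rewrite forest_leaves_cons size_cat.
by have := leaves_gt0 T; lia.
Qed.

Lemma size_forest_leaves_children F :
  size (forest_leaves F)
  = (count is_leaf F + size (forest_leaves (children F)))%N.
Proof.
elim: F => //= T F IH; rewrite forest_leaves_cons size_cat IH.
case: T => [c|l r] //=.
rewrite /children /= -/(children F) !forest_leaves_cons !size_cat; lia.
Qed.

Lemma size_children F :
  (size (children F) + (count is_leaf F).*2 = (size F).*2)%N.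
Proof.
elim: F => //= T F IH; case: T => [c|l r] /=;
  rewrite /children /= -/(children F); lia.
Qed.

Lemma subseq_children F :
  subseq (forest_leaves (children F)) (forest_leaves F).
Proof.
elim: F => //= -[c|l r] F IH.
  by rewrite forest_leaves_cons; apply: (subseq_trans IH); apply: subseq_cons.
rewrite /children /= -/(children F) !forest_leaves_cons /= catA.
exact: cat_subseq.
Qed.

(* Summation by parts along the levels. *)
Lemma forest_weight_children phi d F :
  forest_weight phi d F
  = phi d * ((forest_freq F)%:R - (forest_freq (children F))%:R)
    + forest_weight phi d.+1 (children F).
Proof.
rewrite /forest_weight /forest_freq.
elim: F => [|T F IH]; first by rewrite /children /= /forest_leaves /= !big_nil; ring.
rewrite big_cons IH forest_leaves_cons big_cat /=.
case: T => [c|l r].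
  by rewrite /children /= big_seq1 -/(children F) natrD; ring.
rewrite {3 4}/children /= -/(children F) !forest_leaves_cons !big_cons !big_cat /= !natrD.
move: (\sum_(i <- leaves l) f i)%:R (\sum_(i <- leaves r) f i)%:R
  (\sum_(i <- forest_leaves F) f i)%:R
  (\sum_(i <- forest_leaves (children F)) f i)%:R => a b c e.
move: (tree_weight _ _ l) (tree_weight _ _ r) => x y.
by move: (\sum_(j <- _) _) (phi d) => z p; ring.
Qed.

End Trees.

(** * The dynamic program *)

Section DynamicProgram.
Variables (R : realType) (n : nat) (f : 'I_n -> nat) (sg : nat -> 'I_n).
Variables (S r : nat -> nat) (g : nat -> R).

(* In state (u, v, j, l) the depth is n - 1 - u, the v least frequent characters
   are still to be placed, j nodes of the current level are undecided and l
   units of rounded code length may still be spent.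
   A cell is (choice, cost): choice 0 marks an infeasible state, 1 a leaf put
   at the current level, 2 a descent to the next level, 3 a completed tree. *)
Definition dp_cell (u v j l : nat) (A B : nat * R) : nat * R :=
  if (v <= 0)%N then (if (j <= 0)%N then (3%N, 0) else (0%N, 0))
  else if (j <= 0)%N then (0%N, 0) else
  let c1 := if (1 <= A.1)%N then (1%N, A.2) else (0%N, 0) in
  if [&& (1 <= u)%N, (j + j <= v)%N, (r v <= l)%N & (1 <= B.1)%N] then
    let x := B.2 + (S v)%:R * g (n - u.+1)%N in
    if (1 <= c1.1)%N && (c1.2 <= x) then c1 else (2%N, x)
  else c1.

(** Lexicographic recursion: a leaf keeps [u] and lowers [v], a descent lowers [u] and keeps [v].
    The count [j] doubles on a descent, so it cannot serve as a measure. *)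
Fixpoint dp (u : nat) : nat -> nat -> nat -> nat * R :=
  fix dpu (v j l : nat) {struct v} : nat * R :=
    dp_cell u v j l
      (if v is v'.+1 then dpu v' j.-1 l else (0%N, 0))
      (if u is u'.+1 then dp u' v (j + j)%N (l - r v)%N else (0%N, 0)).

Lemma dpE u v j l :
  dp u v j l
  = dp_cell u v j l (dp u v.-1 j.-1 l) (dp u.-1 v (j + j)%N (l - r v)%N).
Proof. by case: u v => [|u] [|v]. Qed.

(** A leaf is free, since everything is charged on descending; the cell can only improve on this
    choice. *)
Lemma dp_leaf_step u v j l : (0 < (dp u v j l).1)%N ->
  (0 < (dp u v.+1 j.+1 l).1)%N /\ (dp u v.+1 j.+1 l).2 <= (dp u v j l).2.
Proof.
move=> h; rewrite [dp u v.+1 j.+1 l]dpE /dp_cell /= h /=.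
case: ifP => // _; case: ifP => //= /negbT; rewrite -ltNge => /ltW; by split.
Qed.

Lemma dp_leaf_steps a u v j l : (0 < (dp u v j l).1)%N ->
  (0 < (dp u (a + v) (a + j) l).1)%N
  /\ (dp u (a + v) (a + j) l).2 <= (dp u v j l).2.
Proof.
move=> h; elim: a => [|a [IH1 IH2]]; first by rewrite !add0n.
have [h1 h2] := dp_leaf_step IH1.
by rewrite !addSn; split=> //; apply: le_trans h2 IH2.
Qed.

Lemma dp_down_step u v j l : (0 < j)%N -> (j + j <= v)%N -> (r v <= l)%N ->
  (0 < (dp u v (j + j) (l - r v)).1)%N ->
  (0 < (dp u.+1 v j l).1)%N /\
  (dp u.+1 v j l).2
  <= (dp u v (j + j) (l - r v)).2 + (S v)%:R * g (n - u.+2)%N.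
Proof.
move=> j0 jv rl h; rewrite [dp u.+1 v j l]dpE /dp_cell /= h jv rl /=.
have -> : (v <= 0)%N = false by lia.
have -> : (j <= 0)%N = false by lia.
by case: ifP => [/andP[]|_].
Qed.

(** * The table is at least as good as every forest *)

Section Completeness.
Hypothesis r0 : r 0 = 0%N.
Hypothesis S0 : S 0 = 0%N.
Implicit Type F : seq (btree 'I_n).

Fixpoint rounded_length u F : nat :=
  if u is u'.+1 then
    (r (size (forest_leaves (children F))) + rounded_length u' (children F))%N
  else 0%N.

(** The price of the profile of [F], with each level total replaced by its lower bound [S]. *)
Fixpoint level_cost u F : R :=
  if u is u'.+1 then
    (S (size (forest_leaves (children F))))%:R * g (n - u'.+2)%N
    + level_cost u' (children F)
  else 0.

Lemma level_cost_nil u : level_cost u [::] = 0.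
Proof. by elim: u => //= u IH; rewrite S0 mul0r add0r IH. Qed.

(** The number of internal nodes is that of the leaves minus that of the trees, so the size
    condition allows at most [u] internal nodes and hence at most [u] descents. On each level the
    leaves are taken first and the remaining nodes descend together, the order that the table
    knows. *)
Lemma dp_complete u F l :
  (size (forest_leaves F) <= size F + u)%N -> (rounded_length u F <= l)%N ->
  (0 < (dp u (size (forest_leaves F)) (size F) l).1)%N
  /\ (dp u (size (forest_leaves F)) (size F) l).2 <= level_cost u F.
Proof.
elim: u F l => [|u IH] F l hs hl.
  have Ea := size_forest_leaves_children F; have Ec := size_children F.
  have Ek := size_forest_leaves (children F); have Ef := size_forest_leaves F.
  have el := count_size (@is_leaf n) F.
  have : (0 < (dp 0 0 0 l).1)%N by rewrite dpE.
  move=> /(dp_leaf_steps (size F)); rewrite !addn0.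
  have -> : size (forest_leaves F) = size F by lia.
  by rewrite [dp 0 0 0 l]dpE.
have Ea := size_forest_leaves_children F; have Ec := size_children F.
have Ek := size_forest_leaves (children F).
have el := count_size (@is_leaf n) F.
set a := count _ _ in Ea Ec el.
have [j0|j0] := posnP (size F - a)%N.
  have /size0nil ck : size (children F) = 0%N by lia.
  have Ev : size (forest_leaves F) = size F by rewrite Ea ck /=; lia.
  have : (0 < (dp u.+1 0 0 l).1)%N by rewrite dpE.
  move=> /(dp_leaf_steps (size F)); rewrite !addn0 Ev.
  by rewrite [dp u.+1 0 0 l]dpE /= ck S0 mul0r add0r level_cost_nil.
move: hl => /= hl.
(* The next level has twice as many nodes as there are internal nodes here; this surplus of at least
   one pays for the lost unit of [u]. *)
have [||h1 h2] := IH (children F) (l - r (size (forest_leaves (children F))))%N.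
- by lia.
- by lia.
have Ej : size (children F) = (size F - a + (size F - a))%N by lia.
have [||||d1 d2] := @dp_down_step u (size (forest_leaves (children F))) (size F - a) l.
- by [].
- by rewrite -Ej.
- by lia.
- by rewrite -Ej.
have [e1 e2] := dp_leaf_steps a d1.
rewrite subnKC in e1 e2; last by lia.
rewrite Ea; split=> //; apply: (le_trans e2); apply: (le_trans d2).
by rewrite addrC lerD2l -Ej.
Qed.

End Completeness.

(** * The forest read off the table *)

Section Soundness.

Fixpoint pair_up F : seq (btree 'I_n) :=
  if F is t1 :: t2 :: F' then Node t1 t2 :: pair_up F' else [::].

Fixpoint dp_forest (u : nat) : nat -> nat -> nat -> seq (btree 'I_n) :=
  fix dpu (v j l : nat) {struct v} : seq (btree 'I_n) :=
    if (dp u v j l).1 == 1%N then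
      (if v is v'.+1 then Leaf (sg v') :: dpu v' j.-1 l else [::])
    else if (dp u v j l).1 == 2%N then
      (if u is u'.+1 then pair_up (dp_forest u' v (j + j)%N (l - r v)%N)
       else [::])
    else [::].

Lemma dp_forestE u v j l :
  dp_forest u v j l =
    if (dp u v j l).1 == 1%N then
      (if v is v'.+1 then Leaf (sg v') :: dp_forest u v' j.-1 l else [::])
    else if (dp u v j l).1 == 2%N then
      (if u is u'.+1 then pair_up (dp_forest u' v (j + j)%N (l - r v)%N)
       else [::])
    else [::].
Proof. by case: u v => [|u] [|v]. Qed.

(** Inverts a cell and its forest together. In the cases of a leaf and of a descent the successor is
    again feasible, which drives the inductions below and the walk of the machine. *)
Variant dp_spec (u v j l : nat) : nat * R -> seq (btree 'I_n) -> Prop :=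
| DpInfeasible : dp_spec u v j l (0%N, 0) [::]
| DpDone of v = 0%N & j = 0%N : dp_spec u v j l (3%N, 0) [::]
| DpLeaf v' j' c of v = v'.+1 & j = j'.+1 & (0 < (dp u v' j' l).1)%N
    & c = (dp u v' j' l).2 :
    dp_spec u v j l (1%N, c) (Leaf (sg v') :: dp_forest u v' j' l)
| DpDown u' c of u = u'.+1 & (0 < j)%N & (j + j <= v)%N & (r v <= l)%N
    & (0 < (dp u' v (j + j) (l - r v)).1)%N
    & c = (dp u' v (j + j) (l - r v)).2 + (S v)%:R * g (n - u.+1)%N :
    dp_spec u v j l (2%N, c)
      (pair_up (dp_forest u' v (j + j)%N (l - r v)%N)).

Lemma dpP u v j l : dp_spec u v j l (dp u v j l) (dp_forest u v j l).
Proof.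
rewrite dp_forestE [dp u v j l]dpE /dp_cell.
case: v => [|v] /=; first by case: j => [|j] /=; constructor.
case: j => [|j] /=; first by constructor.
case: u => [|u] /=.
  by case: ifP => h /=; constructor.
case: (ltnP 0 (dp u.+1 v j l).1) => hA /=; case: ifP => /= [/and3P[jv rv hB]|_].
- case: ifP => _ /=; [exact: DpLeaf | exact: DpDown].
- exact: DpLeaf.
- exact: DpDown.
- exact: DpInfeasible.
Qed.

Lemma size_pair_up F m : size F = (m + m)%N -> size (pair_up F) = m.
Proof.
elim: m F => [|m IH] [|t1 [|t2 F]] //= e; try lia.
by rewrite IH //; lia.
Qed.

Lemma forest_leaves_pair_up F m : size F = (m + m)%N ->
  forest_leaves (pair_up F) = forest_leaves F.
Proof.
elim: m F => [|m IH] [|t1 [|t2 F]] //= e; try lia.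
rewrite !forest_leaves_cons /= IH ?catA //; lia.
Qed.

Lemma forest_weight_pair_up phi d F m : size F = (m + m)%N ->
  forest_weight f phi d (pair_up F) = forest_weight f phi d.+1 F :> R.
Proof.
elim: m F => [|m IH] [|t1 [|t2 F]] //= e; try lia.
  by rewrite /forest_weight !big_nil.
have {}e : size F = (m + m)%N by lia.
by have := IH F e; rewrite /forest_weight !big_cons /= addrA => ->.
Qed.

Lemma nth_pair_up t0 F k m : size F = (m + m)%N -> (k < m)%N ->
  nth t0 (pair_up F) k = Node (nth t0 F (k + k)) (nth t0 F (k + k).+1).
Proof.
elim: m F k => [|m IH] [|t1 [|t2 F]] [|k] //= e km; try lia.
by rewrite addnS /= IH //; lia.
Qed.

Lemma dp_feasible_ind
    (P : nat -> nat -> nat -> nat -> R -> seq (btree 'I_n) -> Prop) :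
  (forall u l, P u 0%N 0%N l 0 [::]) ->
  (forall u v j l c F, P u v j l c F ->
     P u v.+1 j.+1 l c (Leaf (sg v) :: F)) ->
  (forall u v j l c F, (0 < j)%N -> (j + j <= v)%N -> (r v <= l)%N ->
     P u v (j + j)%N (l - r v)%N c F ->
     P u.+1 v j l (c + (S v)%:R * g (n - u.+2)%N) (pair_up F)) ->
  forall u v j l, (0 < (dp u v j l).1)%N ->
    P u v j l (dp u v j l).2 (dp_forest u v j l).
Proof.
move=> P0 PL PD u v; have [k] := ubnP (u + v)%N.
elim: k u v => // k IH u v uvk j l.
case: dpP => //= [-> -> _|v' j' c ev -> h -> _|u' c eu j0 jv rl h -> _].
- exact: P0.
- by rewrite ev; apply: PL; apply: IH => //; lia.
- by rewrite eu; apply: PD => //; apply: IH => //; lia.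
Qed.

Lemma size_dp_forest u v j l : (0 < (dp u v j l).1)%N ->
  size (dp_forest u v j l) = j.
Proof.
move: u v j l; apply: (@dp_feasible_ind (fun _ _ j _ _ F => size F = j)) => //=.
  by move=> _ _ j _ _ F ->.
by move=> _ v j _ _ F _ _ _; apply: size_pair_up.
Qed.

Lemma forest_leaves_dp u v j l : (0 < (dp u v j l).1)%N ->
  perm_eq (forest_leaves (dp_forest u v j l)) [seq sg k | k <- iota 0 v].
Proof.
(* The size is carried along because [pair_up] drops a last tree without partner. *)
move: u v j l; pose P (u v j l : nat) (c : R) F :=
  size F = j /\ perm_eq (forest_leaves F) [seq sg k | k <- iota 0 v].
suff H : forall u v j l, (0 < (dp u v j l).1)%N ->
    P u v j l (dp u v j l).2 (dp_forest u v j l).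
  by move=> u v j l /H[].
apply: dp_feasible_ind => //.
- move=> u v j l c F [<- h]; split=> //.
  rewrite forest_leaves_cons -addn1 iotaD map_cat /= add0n perm_sym.
  by rewrite perm_catC /= perm_cons perm_sym.
- move=> u v j l c F _ _ _ [e h]; split; first exact: size_pair_up.
  by rewrite (forest_leaves_pair_up e).
Qed.

Hypothesis S0 : S 0 = 0%N.
Hypothesis SS : forall v, S v.+1 = (S v + f (sg v))%N.

(** The first summand is what the [v] characters would cost if all sat on the current level; the
    table records the increments below it. Equality holds because exactly the characters [sg 0],
    ..., [sg v.-1] are left, with total frequency [S v]. *)
Lemma dp_cost (Q : nat -> R) u v j l :
  (u < n)%N -> (forall d, Q d.+1 = Q d + g d) -> (0 < (dp u v j l).1)%N ->
  forest_weight f Q (n - u.+1) (dp_forest u v j l)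
  = Q (n - u.+1)%N * (S v)%:R + (dp u v j l).2.
Proof.
move=> + hQ; move: u v j l; pose P (u v j l : nat) (c : R) F :=
  size F = j /\ ((u < n)%N -> forest_weight f Q (n - u.+1) F
  = Q (n - u.+1)%N * (S v)%:R + c).
suff H : forall u v j l, (0 < (dp u v j l).1)%N ->
    P u v j l (dp u v j l).2 (dp_forest u v j l).
  by move=> u v j l un /H[_ /(_ un)].
apply: dp_feasible_ind => //.
- by move=> u l; split=> // _; rewrite /forest_weight big_nil S0 mulr0 addr0.
- move=> u v j l c F [<- h]; split=> // /h {}h.
  by rewrite /forest_weight big_cons -/(forest_weight _ _ _ F) h SS natrD /=; ring.
- move=> u v j l c F _ _ _ [e h]; split=> [|un]; first exact: size_pair_up.
  rewrite (forest_weight_pair_up _ _ e).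
  have E : (n - u.+1 = (n - u.+2).+1)%N by lia.
  by move: (h (ltnW un)); rewrite -E => ->; rewrite E hQ; ring.
Qed.

(** A descent adds [S v] to the true length and takes [r v] units from [l]. Since [round_up] is
    truncated, [S v <= delta * r v] is available only while [r v] is within the budget, hence the
    guard [N]. *)
Lemma dp_length (delta : R) (N : nat) u v j l :
  (forall v, (r v <= N)%N -> (S v)%:R <= delta * (r v)%:R) -> 0 <= delta ->
  (u < n)%N -> (l <= N)%N -> (0 < (dp u v j l).1)%N ->
  forest_weight f (fun d => d%:R) (n - u.+1) (dp_forest u v j l)
  <= (n - u.+1)%:R * (S v)%:R + delta * l%:R.
Proof.
move=> hr d0; move: u v j l; pose P (u v j l : nat) (c : R) F :=
  size F = j /\ ((u < n)%N -> (l <= N)%N ->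
  forest_weight f (fun d => d%:R) (n - u.+1) F
  <= (n - u.+1)%:R * (S v)%:R + delta * l%:R).
suff H : forall u v j l, (0 < (dp u v j l).1)%N ->
    P u v j l (dp u v j l).2 (dp_forest u v j l).
  by move=> u v j l un lN /H[_ /(_ un lN)].
apply: dp_feasible_ind => //.
- move=> u l; split=> // _ _; rewrite /forest_weight big_nil S0 mulr0 add0r.
  by rewrite mulr_ge0.
- move=> u v j l c F [<- h]; split=> // un lN; have {}h := h un lN.
  rewrite /forest_weight big_cons -/(forest_weight _ _ _ F) SS natrD /=.
  by rewrite mulrDr addrAC [X in _ <= X]addrC [X in _ <= X + _]mulrC lerD2l.
- move=> u v j l c F _ _ rl [e h]; split=> [|un lN]; first exact: size_pair_up.
  rewrite (forest_weight_pair_up _ _ e).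
  have E : (n - u.+1 = (n - u.+2).+1)%N by lia.
  have := h (ltnW un) (leq_trans (leq_subr _ _) lN); rewrite -E => /le_trans; apply.
  rewrite E -natr1 (natrB _ rl).
  have := hr v (leq_trans rl lN); move: (n - u.+2)%:R => x; lra.
Qed.

End Soundness.

(** * Level totals of an arbitrary forest *)

Section Cost.
Hypothesis SS : forall v, S v = (\sum_(k < v) f (sg k))%N.
Hypothesis sg_sorted : forall x y, (x <= y < n)%N -> (f (sg x) <= f (sg y))%N.
Hypothesis sg_perm : perm_eq [seq sg k | k <- iota 0 n] (enum 'I_n).

Lemma smallest_sum_le (X : seq 'I_n) : uniq X ->
  (S (size X) <= \sum_(c <- X) f c)%N.
Proof.
move=> uX.
have hsg c : {k | (k < n)%N & sg k = c}.
  apply: cid2.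
  have : c \in [seq sg k | k <- iota 0 n] by rewrite (perm_mem sg_perm) mem_enum.
  by case/mapP => k; rewrite mem_iota /= => kn ->; exists k.
pose rk c := s2val (hsg c).
have rkK : cancel rk sg by move=> c; rewrite /rk; case: (hsg c).
have rkn c : (rk c < n)%N by rewrite /rk; case: (hsg c).
(* Capping the index extends the sorted frequencies to a monotone function on all naturals, as
   [sum_uniq_ge] requires. *)
pose h k := f (sg (minn k n.-1)).
have hh : {homo h : x y / (x <= y)%N}.
  move=> x y xy; rewrite /h; apply: sg_sorted.
  by have := ltn_ord (sg 0); lia.
have H := @sum_uniq_ge h n (map rk X) hh _ _.
rewrite big_map size_map in H; rewrite SS.
have -> : (\sum_(c <- X) f c = \sum_(c <- X) h (rk c))%N.
  apply: eq_bigr => c _; rewrite /h (minn_idPl _) ?rkK //.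
  by have := rkn c; lia.
have sX : (size X <= n)%N.
  by have := max_card (mem X); rewrite (card_uniqP uX) card_ord.
have -> : (\sum_(k < size X) f (sg k) = \sum_(k < size X) h k)%N.
  apply: eq_bigr => k _; rewrite /h (minn_idPl _) //.
  have := ltn_ord k; lia.
apply: H; first by rewrite map_inj_uniq //; apply: can_inj rkK.
by apply/allP => _ /mapP[c _ ->].
Qed.

(** Counterpart of [dp_cost] for any forest: after summation by parts each total belongs to distinct
    characters, so it is at least [S], and the prices [g] are nonnegative. *)
Lemma level_cost_le (Q : nat -> R) u F :
  (u < n)%N -> (forall d, Q d.+1 = Q d + g d) -> (forall d, 0 <= g d) ->
  uniq (forest_leaves F) -> (size (forest_leaves F) <= size F + u)%N ->
  Q (n - u.+1)%N * (forest_freq f F)%:R + level_cost u F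
  <= forest_weight f Q (n - u.+1) F.
Proof.
move=> + hQ g0; elim: u F => [|u IH] F un uF sF.
  rewrite forest_weight_children.
  have Ea := size_forest_leaves_children F; have Ec := size_children F.
  have Ek := size_forest_leaves (children F); have el := count_size (@is_leaf n) F.
  have /size0nil -> : size (children F) = 0%N by lia.
  rewrite /forest_weight /forest_freq /forest_leaves /= !big_nil; lra.
have uK : uniq (forest_leaves (children F)).
  exact: subseq_uniq (subseq_children F) uF.
have sK : (size (forest_leaves (children F)) <= size (children F) + u)%N.
  have Ea := size_forest_leaves_children F; have Ec := size_children F.
  have el := count_size (@is_leaf n) F.
  have [] := posnP (size (children F)); last by lia.
  by move/size0nil => ->.
have := IH _ (ltnW un) uK sK.
rewrite [forest_weight _ _ _ F]forest_weight_children.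
have E : (n - u.+1 = (n - u.+2).+1)%N by lia.
rewrite E hQ /=.
have : ((S (size (forest_leaves (children F))))%:R
          <= (forest_freq f (children F))%:R :> R).
  by rewrite ler_nat smallest_sum_le.
move=> /(ler_wpM2r (g0 (n - u.+2)%N)); lra.
Qed.

End Cost.
End DynamicProgram.

(** * Block costs, rounding and ranking *)

Section Blocks.
Variables (R : realType) (bs : scheme R).
Hypothesis bs_valid : valid_scheme bs.

(** [char_decode_time] as a function of the depth alone. *)
Definition block_cost (d : nat) : R :=
  \sum_(p <- take (find (fun h => d <= width_upto bs h)%N
                        (iota 0 (size bs).+1)) bs) p.2.

(** The number of blocks in incremental form, computable in one pass over the depths: a new block
    opens when the current ones are full. *)
Fixpoint blocks_used (d : nat) : nat :=
  if d is d'.+1 then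
    if (width_upto bs (blocks_used d') <= d')%N then (blocks_used d').+1
    else blocks_used d'
  else 0%N.

Definition level_price (d : nat) : R :=
  if (width_upto bs (blocks_used d) <= d)%N
  then nth 0 (unzip2 bs) (blocks_used d) else 0.

Lemma width_upto0 : width_upto bs 0 = 0%N.
Proof. by rewrite /width_upto take0 big_nil. Qed.

Lemma width_uptoS h :
  width_upto bs h.+1 = (width_upto bs h + nth 0 (unzip1 bs) h)%N.
Proof.
rewrite /width_upto; have [hs|hs] := ltnP h (size bs).
  rewrite (take_nth (0%N, 0)) // -cats1 big_cat big_seq1 /=.
  by rewrite (nth_map (0%N, 0)).
by rewrite !take_oversize ?(leqW hs) // nth_default ?addn0 // size_map.
Qed.

Lemma width_upto_ltS h : (h < size bs)%N ->
  (width_upto bs h < width_upto bs h.+1)%N.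
Proof.
move=> hs; rewrite width_uptoS -[X in (X < _)%N]addn0 ltn_add2l.
rewrite (nth_map (0%N, 0)) //.
by case: (bs_valid (mem_nth (0%N, 0) hs)).
Qed.

Lemma find_iota0 (a : pred nat) m h : (h < m)%N -> a h ->
  (forall k, (k < h)%N -> ~~ a k) -> find a (iota 0 m) = h.
Proof.
move=> hm ah nh.
have hs : has a (iota 0 m) by apply/hasP; exists h; rewrite // mem_iota.
have := nth_find 0 hs; rewrite nth_iota ?add0n => [af|]; last first.
  by move: hs; rewrite has_find size_iota.
apply/eqP; rewrite eqn_leq; apply/andP; split; rewrite leqNgt; apply/negP => H.
  have := before_find 0 H; rewrite nth_iota // add0n ah //.
by have := nh _ H; rewrite af.
Qed.

Lemma block_costE d :
  block_cost d = \sum_(p <- take (blocks_used d) bs) p.2.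
Proof.
(* Either [blocks_used d] is the least sufficient number of blocks, or the scheme is too short for
   depth [d]; then both sides sum over the whole scheme. *)
have : [/\ blocks_used d <= size bs, d <= width_upto bs (blocks_used d)
         & forall h, h < blocks_used d -> width_upto bs h < d]%N \/
       (size bs <= blocks_used d /\ width_upto bs (size bs) < d)%N.
  elim: d => [|d [[h1 h2 h3]|[h1 h2]]] /=.
  - by left.
  - case: (leqP (width_upto bs (blocks_used d)) d) => h4; last by left; split => // h /h3; lia.
    move: h1; rewrite leq_eqVlt => /orP[/eqP h1|h1].
      by right; rewrite -h1; lia.
    left; split => // [|h]; first by have := width_upto_ltS h1; lia.
    by rewrite ltnS leq_eqVlt => /orP[/eqP->|/h3]; lia.
  - by right; case: ifP; lia.
rewrite /block_cost => -[[h1 h2 h3]|[h1 h2]].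
  by rewrite (@find_iota0 _ _ (blocks_used d)) // => h /h3; lia.
rewrite (take_oversize h1) hasNfind ?size_iota ?take_oversize //.
apply/hasPn => h; rewrite mem_iota add0n ltnS /= -ltnNge => hs.
apply: leq_ltn_trans h2.
elim: (size bs) hs => [|m IH]; first by rewrite leqn0 => /eqP->.
rewrite leq_eqVlt ltnS => /orP[/eqP->//|/IH]; rewrite width_uptoS; lia.
Qed.

Lemma block_cost0 : block_cost 0 = 0.
Proof. by rewrite block_costE /= take0 big_nil. Qed.

Lemma block_costS d : block_cost d.+1 = block_cost d + level_price d.
Proof.
rewrite !block_costE /level_price /=; case: ifP => _; last by rewrite addr0.
have [hs|hs] := ltnP (blocks_used d) (size bs).
  rewrite (take_nth (0%N, 0)) // -cats1 big_cat big_seq1 /=.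
  by rewrite (nth_map (0%N, 0)).
by rewrite !take_oversize ?(leqW hs) // nth_default ?addr0 // size_map.
Qed.

Lemma level_price_ge0 d : 0 <= level_price d.
Proof.
rewrite /level_price; case: ifP => // _.
have [hs|hs] := ltnP (blocks_used d) (size bs); last first.
  by rewrite nth_default // size_map.
rewrite (nth_map (0%N, 0)) //.
by case: (bs_valid (mem_nth (0%N, 0) hs)).
Qed.

End Blocks.

(** The decode time depends only on the block number of each character, so the minimum is taken over
    a finite type of functions and trees need not be enumerated. *)
Lemma dopt_exists (R : realType) (C : finType) (freq : C -> nat)
    (bs : scheme R) (L : R) :
  (exists T0, admissible freq L T0) -> exists v, is_DOPT freq bs L v.
Proof.
move=> [T0 aT0].
have nb (T : btree C) c : (nblocks bs T c < (size bs).+2)%N.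
  by rewrite ltnS; have := find_size (fun h => depth T c <= width_upto bs h)%N
    (iota 0 (size bs).+1); rewrite size_iota.
pose code T : {ffun C -> 'I_(size bs).+2} := [ffun c => Ordinal (nb T c)].
pose cost (e : {ffun C -> 'I_(size bs).+2}) : R :=
  \sum_c (freq c)%:R * \sum_(p <- take (e c) bs) p.2.
have costE T : decode_time freq bs T = cost (code T).
  by apply: eq_bigr => c _; rewrite ffunE.
pose P e := `[< exists2 T, admissible freq L T & code T = e >].
have P0 : P (code T0) by apply/asboolP; exists T0.
case: (Order.TotalTheory.arg_minP cost P0) => e /asboolP[T aT eT] emin.
exists (cost e); split; first by exists T => //; rewrite costE eT.
by move=> T' aT'; rewrite costE; apply: emin; apply/asboolP; exists T'.
Qed.

(** * Rounding up to multiples of the unit *)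

Section Rounding.
Variables (R : realType) (delta : R) (B : nat).
Hypothesis delta0 : 0 <= delta.

(* ceil (x / delta) truncated at B + 1; unlike the quotient this is meaningful
   for delta = 0. *)
Definition round_up (x : R) : nat :=
  (\sum_(k < B.+1) ~~ (x <= k%:R * delta)%R)%N.

Lemma round_up_le x m : x <= m%:R * delta -> (round_up x <= m)%N.
Proof.
move=> xm; rewrite /round_up.
have [mB|Bm] := leqP B.+1 m.
  apply: leq_trans (mB); rewrite -[X in (_ <= X)%N]card_ord -sum1_card.
  by apply: leq_sum => k _; case: (_ <= _).
rewrite -(big_mkord xpredT (fun k => nat_of_bool (~~ (x <= k%:R * delta)))).
rewrite (@big_cat_nat _ _ _ m) ?(ltnW Bm) //= [X in (_ + X)%N]big_nat.
rewrite [X in (_ + X)%N]big1 ?addn0; last first.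
  move=> k /andP[mk _]; suff -> : x <= k%:R * delta by [].
  by apply: le_trans xm _; rewrite ler_wpM2r // ler_nat.
rewrite -[X in (_ <= X)%N]subn0 -[X in (_ <= X)%N]muln1 -sum_nat_const_nat.
by apply: leq_sum => k _; case: (_ <= _).
Qed.

Lemma round_up_ge x m : (m <= B)%N -> m%:R * delta < x -> (m < round_up x)%N.
Proof.
move=> mB xm; rewrite /round_up.
rewrite -(big_mkord xpredT (fun k => nat_of_bool (~~ (x <= k%:R * delta)))).
rewrite (@big_cat_nat _ _ _ m.+1) //=; apply: leq_trans (leq_addr _ _).
rewrite -[X in (X <= _)%N]subn0 -[X in (X <= _)%N]muln1 -sum_nat_const_nat.
rewrite !big_nat; apply: leq_sum => k /andP[_ km]; rewrite -ltNge.
suff -> : k%:R * delta < x by [].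
by apply: le_lt_trans xm; rewrite ler_wpM2r // ler_nat.
Qed.

Lemma le_round_up x : (round_up x <= B)%N -> x <= delta * (round_up x)%:R.
Proof.
move=> rB; rewrite leNgt mulrC; apply/negP => /(round_up_ge rB).
by rewrite ltnn.
Qed.

Lemma round_up_lt x : 0 <= x -> delta * (round_up x)%:R <= x + delta.
Proof.
move=> x0; case E : (round_up x) => [|m]; first by rewrite mulr0 addr_ge0.
rewrite -natr1 mulrDr mulr1 lerD2r leNgt mulrC; apply/negP => /ltW /round_up_le.
by rewrite E ltnn.
Qed.

Lemma round_up0 : round_up 0 = 0%N.
Proof. by apply/eqP; rewrite -leqn0 round_up_le // mul0r. Qed.

Variables (n : nat) (S : nat -> nat).

Lemma rounded_length_le u (F : seq (btree 'I_n)) :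
  delta * (rounded_length (fun v => round_up (S v)%:R) u F)%:R
  <= level_cost S (fun=> 1) u F + delta * u%:R.
Proof.
elim: u F => [|u IH] F /=; first by rewrite !mulr0 addr0.
rewrite -natr1 natrD !mulrDr !mulr1.
have := IH (children F).
have := round_up_lt (ler0n R (S (size (forest_leaves (children F))))).
lra.
Qed.

Lemma level_cost1_ge0 u (F : seq (btree 'I_n)) : 0 <= level_cost S (fun=> 1 : R) u F.
Proof. by elim: u F => [|u IH] F //=; rewrite addr_ge0 // mulr1. Qed.

(** Serves the case [L = 0], where [delta = 0] and [rounded_length_le] does not bound the number of
    units. *)
Lemma rounded_length_eq0 u (F : seq (btree 'I_n)) :
  level_cost S (fun=> 1 : R) u F <= 0 ->
  rounded_length (fun v => round_up (S v)%:R) u F = 0%N.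
Proof.
elim: u F => [|u IH] F //=; rewrite mulr1 => h.
have h1 := level_cost1_ge0 u (children F).
have h2 := ler0n R (S (size (forest_leaves (children F)))).
have /eqP -> : (S (size (forest_leaves (children F))))%:R == 0 :> R.
  by rewrite eq_le h2 andbT; lra.
by rewrite round_up0 IH //; lra.
Qed.

End Rounding.

(** * Ranking the characters by frequency *)

Section Ranking.
Variables (n : nat) (f : 'I_n -> nat) (o0 : 'I_n).

(** The strict lexicographic order on frequency and index; breaking ties by index makes ranks
    distinct. *)
Definition before (c' c : 'I_n) : bool :=
  (f c' <= f c)%N && ~~ ((f c <= f c')%N && (c <= c')%N).

Definition rank (c : 'I_n) : nat := \sum_(c' < n) before c' c.

Lemma rankE c : rank c = #|[pred x | before x c]|.
Proof. by rewrite -sum1_card big_mkcond. Qed.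

Lemma rank_lt c c' : before c c' -> (rank c < rank c')%N.
Proof.
move=> cc'; rewrite !rankE; apply: proper_card; apply/properP; split.
  apply/subsetP => x; rewrite !inE; move: cc'; rewrite /before; lia.
by exists c; rewrite !inE // /before; lia.
Qed.

Lemma rank_ltn c : (rank c < n)%N.
Proof.
rewrite rankE -[X in (_ < X)%N]card_ord; apply: proper_card.
apply/properP; split; first exact/subsetP.
by exists c; rewrite // inE /before; lia.
Qed.

Definition rank_ord c := Ordinal (rank_ltn c).

Lemma rank_ord_inj : injective rank_ord.
Proof.
move=> c c' /(congr1 val) /= e; apply/val_inj; apply/eqP.
have := @rank_lt c c'; have := @rank_lt c' c; rewrite e ltnn /before.
case: (ltngtP (f c) (f c')) => //=; case: (ltngtP (val c) (val c')) => //=;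
  lia.
Qed.

Definition by_freq (k : nat) : 'I_n :=
  if insub k is Some o then invF rank_ord_inj o else o0.

Lemma rank_by_freq k : (k < n)%N -> rank (by_freq k) = k.
Proof.
move=> kn; rewrite /by_freq insubT.
by have /(congr1 val) := f_invF rank_ord_inj (Ordinal kn).
Qed.

Lemma by_freq_sorted x y : (x <= y < n)%N ->
  (f (by_freq x) <= f (by_freq y))%N.
Proof.
move=> xyn; rewrite leqNgt; apply/negP => h.
have : before (by_freq y) (by_freq x) by rewrite /before; lia.
by move/rank_lt; rewrite !rank_by_freq; lia.
Qed.

Lemma by_freq_perm : perm_eq [seq by_freq k | k <- iota 0 n] (enum 'I_n).
Proof.
apply: uniq_perm; last 1 first.
- move=> c; rewrite mem_enum inE; apply/mapP; exists (rank c).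
    by rewrite mem_iota rank_ltn.
  apply: rank_ord_inj; apply: val_inj => /=.
  by rewrite rank_by_freq ?rank_ltn.
- rewrite map_inj_in_uniq ?iota_uniq // => x y; rewrite !mem_iota /= => xn yn.
  by move/(congr1 rank); rewrite !rank_by_freq.
- exact: enum_uniq.
Qed.

End Ranking.

(** * Timed reasoning about machine programs *)

Fixpoint nmods (c : cmd) : seq nat :=
  match c with
  | NSet a _ _ => [:: a]
  | Seq c1 c2 | If _ c1 c2 => nmods c1 ++ nmods c2
  | While _ c1 => nmods c1
  | _ => [::]
  end.

Fixpoint rmods (c : cmd) : seq nat :=
  match c with
  | RSet a _ _ => [:: a]
  | Seq c1 c2 | If _ c1 c2 => rmods c1 ++ rmods c2
  | While _ c1 => rmods c1
  | _ => [::]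
  end.

Fixpoint loop_free (c : cmd) : bool :=
  match c with
  | Seq c1 c2 | If _ c1 c2 => loop_free c1 && loop_free c2
  | While _ _ => false
  | _ => true
  end.

(** Only an upper bound: a conditional is charged for both branches. *)
Fixpoint loop_free_time (c : cmd) : nat :=
  match c with
  | Skip => 1
  | NSet _ i e => (ncost i + ncost e).+1
  | RSet _ i e => (ncost i + rcost e).+1
  | Seq c1 c2 => loop_free_time c1 + loop_free_time c2
  | If b c1 c2 => (bcost b + (loop_free_time c1 + loop_free_time c2)).+1
  | While _ _ => 0
  end.

Definition nvar (a : nat) : nexp := NGet a (NLit 0).
Definition nassign (a : nat) (e : nexp) : cmd := NSet a (NLit 0) e.

(** The bound [e] is evaluated anew in every round, so [wp_for] asks that its value survive the
    loop. *)
Definition For (x : nat) (e : nexp) (c : cmd) : cmd :=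
  Seq (nassign x (NLit 0))
      (While (BNot (BLeN e (nvar x)))
             (Seq c (nassign x (NAdd (nvar x) (NLit 1))))).

Definition for_time (N Tb ce : nat) : nat := (N.+1 * (Tb + ce + 20))%N.

Section WP.
Variable R : realType.
Implicit Types (s : state R) (Q : state R -> Prop).

Fixpoint run (c : cmd) (s : state R) : state R :=
  match c with
  | NSet a i e => State (upd (nmem s) a (neval s i) (neval s e)) (rmem s)
  | RSet a i e => State (nmem s) (upd (rmem s) a (neval s i) (reval s e))
  | Seq c1 c2 => run c2 (run c1 s)
  | If b c1 c2 => if beval s b then run c1 s else run c2 s
  | _ => s
  end.

Definition wp (c : cmd) (T : nat) Q s : Prop :=
  exists t s', [/\ exec c s t s', (t <= T)%N & Q s'].

Definition agree (A B : seq nat) s s' : Prop :=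
  (forall a i, a \notin A -> nmem s' a i = nmem s a i) /\
  (forall a i, a \notin B -> rmem s' a i = rmem s a i).

Lemma agree_trans A B s1 s2 s3 :
  agree A B s1 s2 -> agree A B s2 s3 -> agree A B s1 s3.
Proof.
move=> [h1 h2] [h3 h4]; split=> a i ha; first by rewrite h3 ?h1.
by rewrite h4 ?h2.
Qed.

Lemma agree_sub A B A' B' s s' : {subset A <= A'} -> {subset B <= B'} ->
  agree A B s s' -> agree A' B' s s'.
Proof.
move=> hA hB [h1 h2]; split=> a i ha; first by rewrite h1 // (contra (hA a)).
by rewrite h2 // (contra (hB a)).
Qed.

Lemma agree_incl A B A' B' s s' :
  all [in A'] A -> all [in B'] B -> agree A B s s' -> agree A' B' s s'.
Proof. by move=> /allP hA /allP hB; apply: agree_sub. Qed.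

Lemma agree_n A B s s' a i :
  agree A B s s' -> a \notin A -> nmem s' a i = nmem s a i.
Proof. by case=> h _; apply: h. Qed.

Lemma agree_r A B s s' a i :
  agree A B s s' -> a \notin B -> rmem s' a i = rmem s a i.
Proof. by case=> _ h; apply: h. Qed.

Lemma exec_agree c s t s' : exec c s t s' -> agree (nmods c) (rmods c) s s'.
Proof.
elim=> {c s t s'} //=.
- by move=> a i e s; split=> //= a' i'; rewrite inE /upd => /negPf->.
- by move=> a i e s; split=> //= a' i'; rewrite inE /upd => /negPf->.
- move=> c1 c2 s1 s2 s3 _ _ _ h1 _ h2; apply: agree_trans.
    by apply: agree_sub h1 => a; rewrite mem_cat => ->.
  by apply: agree_sub h2 => a; rewrite mem_cat => ->; rewrite orbT.
- move=> b c1 c2 s1 s2 _ _ _ h1.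
  by apply: agree_sub h1 => a; rewrite mem_cat => ->.
- move=> b c1 c2 s1 s2 _ _ _ h1.
  by apply: agree_sub h1 => a; rewrite mem_cat => ->; rewrite orbT.
- by move=> b c s1 s2 s3 _ _ _ _ h1 _; apply: agree_trans.
Qed.

(** The continuation also receives the frame condition, so a specification need only describe what
    its program changes. *)
Lemma wp_conseq c T T' Q Q' s : wp c T Q s -> (T <= T')%N ->
  (forall s', agree (nmods c) (rmods c) s s' -> Q s' -> Q' s') ->
  wp c T' Q' s.
Proof.
move=> [t [s' [h1 h2 h3]]] TT QQ; exists t, s'.
split=> //; first exact: leq_trans TT.
by apply: QQ h3; apply: exec_agree h1.
Qed.

Lemma wp_seq c1 c2 T1 T2 Q1 Q s : wp c1 T1 Q1 s ->
  (forall s', agree (nmods c1) (rmods c1) s s' -> Q1 s' -> wp c2 T2 Q s') ->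
  wp (Seq c1 c2) (T1 + T2) Q s.
Proof.
move=> [t1 [s1 [e1 l1 q1]]] h2.
have [t2 [s2 [e2 l2 q2]]] := h2 s1 (exec_agree e1) q1.
by exists (t1 + t2)%N, s2; split; [apply: ExSeq e2 | apply: leq_add |].
Qed.

Lemma wp_run c Q s : loop_free c -> Q (run c s) -> wp c (loop_free_time c) Q s.
Proof.
move=> lc hQ.
suff [t et lt] : exists2 t, exec c s t (run c s) & (t <= loop_free_time c)%N.
  by exists t, (run c s).
elim: c s lc {hQ} => //=.
- by move=> s _; exists 1%N => //; constructor.
- by move=> a i e s _; exists (ncost i + ncost e).+1 => //; constructor.
- by move=> a i e s _; exists (ncost i + rcost e).+1 => //; constructor.
- move=> c1 IH1 c2 IH2 s /andP[l1 l2].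
  have [t1 e1 h1] := IH1 s l1; have [t2 e2 h2] := IH2 (run c1 s) l2.
  by exists (t1 + t2)%N; [apply: ExSeq e2 | apply: leq_add].
- move=> b c1 IH1 c2 IH2 s /andP[l1 l2]; case: ifP => hb.
    have [t1 e1 h1] := IH1 s l1.
    by exists (bcost b + t1).+1; [apply: ExIfTrue | lia].
  have [t2 e2 h2] := IH2 s l2.
  by exists (bcost b + t2).+1; [apply: ExIfFalse; rewrite ?hb | lia].
Qed.

Lemma wp_if b c1 c2 T Q s :
  (beval s b -> wp c1 T Q s) -> (~~ beval s b -> wp c2 T Q s) ->
  wp (If b c1 c2) (bcost b + T).+1 Q s.
Proof.
move=> h1 h2; case: (boolP (beval s b)) => hb.
  have [t [s' [e l q]]] := h1 hb; exists (bcost b + t).+1, s'.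
  by split=> //; [apply: ExIfTrue | lia].
have [t [s' [e l q]]] := h2 hb; exists (bcost b + t).+1, s'.
by split=> //; [apply: ExIfFalse | lia].
Qed.

Lemma wp_while_false b c Q s :
  ~~ beval s b -> Q s -> wp (While b c) (bcost b).+1 Q s.
Proof. by move=> hb hQ; exists (bcost b).+1, s; split=> //; constructor. Qed.

Lemma wp_while_true b c T1 T2 Q1 Q s : beval s b -> wp c T1 Q1 s ->
  (forall s', agree (nmods c) (rmods c) s s' -> Q1 s' ->
     wp (While b c) T2 Q s') ->
  wp (While b c) (bcost b + T1 + T2).+1 Q s.
Proof.
move=> hb [t1 [s1 [e1 l1 q1]]] h2.
have [t2 [s2 [e2 l2 q2]]] := h2 s1 (exec_agree e1) q1.
exists (bcost b + t1 + t2).+1, s2; split=> //; first exact: ExWhileTrue e2.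
by rewrite ltnS leq_add // leq_add2l.
Qed.

Definition set_var s (x v : nat) : state R :=
  State (upd (nmem s) x 0 v) (rmem s).

Lemma wp_for x e c N Tb (I : nat -> state R -> Prop) s :
  x \notin nmods c ->
  (forall s', agree (nmods (For x e c)) (rmods (For x e c)) s s' ->
     neval s' e = N) ->
  I 0 (set_var s x 0) ->
  (forall k s', (k < N)%N ->
     agree (nmods (For x e c)) (rmods (For x e c)) s s' ->
     nmem s' x 0 = k -> I k s' ->
     wp c Tb (fun s'' => I k.+1 (set_var s'' x k.+1)) s') ->
  wp (For x e c) (for_time N Tb (ncost e)) (I N) s.
Proof.
move=> xc eN I0 Ibody.
pose w := While (BNot (BLeN e (nvar x)))
             (Seq c (nassign x (NAdd (nvar x) (NLit 1)))).
pose ag := agree (nmods (For x e c)) (rmods (For x e c)) s.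
(* Besides the body and the evaluation of [e], a round spends 11 units on the test, the increment
   and the loop itself; the initial assignment takes 3 more, which the 20 of [for_time] absorbs. *)
suff H k s' : (k <= N)%N -> ag s' -> nmem s' x 0 = k -> I k s' ->
    wp w ((N - k).+1 * (Tb + ncost e + 12))%N (I N) s'.
  rewrite /for_time.
  apply: (@wp_conseq _ (3 + (N - 0).+1 * (Tb + ncost e + 12))%N _ (I N)) => //;
    last by rewrite subn0; nia.
  apply: (@wp_seq _ _ 3 _ (fun s' => s' = set_var s x 0)).
    exact: (@wp_run (nassign x (NLit 0))).
  move=> s' _ ->; apply: H => //.
    split=> a i //=; rewrite inE /upd => /norP[/negPf->] //.
  by rewrite /= /upd !eqxx.
move: {2}(N - k)%N (erefl (N - k)%N) => m.
elim: m k s' => [|m IH] k s' Nk kN ags' xk Ik.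
  have {}Nk : k = N by lia.
  rewrite {}Nk in xk Ik *; apply: (@wp_conseq _ (bcost (BNot (BLeN e (nvar x)))).+1 _ (I N)) => //.
    apply: wp_while_false => //=; by rewrite xk eN // leqnn.
  by rewrite /=; nia.
apply: (@wp_conseq _ (bcost (BNot (BLeN e (nvar x))) + (Tb + 6)
  + ((N - k.+1).+1 * (Tb + ncost e + 12))).+1 _ (I N)) => //; last first.
  have -> : (N - k = (N - k.+1).+1)%N by lia.
  by rewrite [X in (_ <= X)%N]mulSn /=; lia.
have kN' : (k < N)%N by lia.
apply: (@wp_while_true _ _ _ _
  (fun s'' => nmem s'' x 0 = k.+1 /\ I k.+1 s'')).
- by rewrite /= xk eN // -ltnNge.
- apply: wp_seq (Ibody k s' kN' ags' xk Ik) _ => s'' ag'' Ik''.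
  apply: (@wp_run (nassign x (NAdd (nvar x) (NLit 1)))) => //=.
  have x'' : nmem s'' x 0 = k by rewrite (agree_n _ ag'').
  rewrite x'' addn1; split=> //.
  by rewrite /upd !eqxx.
- move=> s'' ag'' [x'' I'']; apply: IH => //; first by lia.
  apply: agree_trans ags' _; apply: agree_sub ag'' => a //= ha.
  by rewrite inE ha orbT.
Qed.

End WP.

(* [isT] proves that the array, a numeral, is not among the modified ones. *)
Ltac trace_back :=
  repeat match goal with
  | F : agree ?A ?B ?s ?s' |- context [nmem ?s' ?a ?i] =>
      rewrite (@agree_n _ A B s s' a i F isT)
  | F : agree ?A ?B ?s ?s' |- context [rmem ?s' ?a ?i] =>
      rewrite (@agree_r _ A B s s' a i F isT)
  end.

(** * The preprocessing programs *)

(* Memory layout.  Natural arrays: 10 the budget B, 11 the characters by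
   increasing frequency, 12 the sums S, 13 their rounded values, 14 and 15 the
   blocks used so far and their total width, 16-18 the multiples of the strides
   of the table (the machine cannot multiply naturals), 21 the choices of the
   table, 22 the choice being computed, 30-33 loop counters, 40-43 the state
   (u, v, j, l) of the walk through the table, 44 and 45 the addresses of the
   node being written and of the next free record, 46 the rank being computed.
   Real arrays: 10 the unit delta, 11 the level prices, 12 the costs of the
   table, 13 and 14 the costs being compared. *)
Definition n_ : nexp := nvar 0.
Definition B_ : nexp := nvar 10.
Definition nsucc (e : nexp) : nexp := NAdd e (NLit 1).
Definition incr (a : nat) : cmd := nassign a (nsucc (nvar a)).

(** True exactly while the counter is below [floor(n/eps)]: counting upwards replaces the missing
    floor. *)
Definition budget_test : bexp :=
  BLeR (RMul (RNat (nsucc B_)) (RGet 0 (NLit 1))) (RNat n_).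

Definition budget_prog : cmd :=
  Seq (nassign 10 (NLit 0))
      (Seq (While budget_test (incr 10)) (nassign 10 (NAdd B_ n_))).

Definition unit_prog : cmd :=
  RSet 10 (NLit 0) (RDiv (RMul (RGet 0 (NLit 1)) (RGet 0 (NLit 0))) (RNat n_)).

Definition before_test : bexp :=
  BAnd (BLeN (NGet 1 (nvar 31)) (NGet 1 (nvar 30)))
       (BNot (BAnd (BLeN (NGet 1 (nvar 30)) (NGet 1 (nvar 31)))
                   (BLeN (nvar 30) (nvar 31)))).

Definition rank_body : cmd := If before_test (incr 46) Skip.

Definition sort_prog : cmd :=
  For 30 n_
    (Seq (nassign 46 (NLit 0))
         (Seq (For 31 n_ rank_body) (NSet 11 (nvar 46) (nvar 30)))).

(** With a constant summand this yields multiples, so it builds the strides as well as the frequency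
    sums. *)
Definition running_sums (a : nat) (N e : nexp) : cmd :=
  Seq (NSet a (NLit 0) (NLit 0))
      (For 30 N (NSet a (nsucc (nvar 30)) (NAdd (NGet a (nvar 30)) e))).

Definition sums_prog : cmd := running_sums 12 n_ (NGet 1 (NGet 11 (nvar 30))).

Definition round_body : cmd :=
  If (BNot (BLeR (RNat (NGet 12 (nvar 30)))
                 (RMul (RNat (nvar 31)) (RGet 10 (NLit 0)))))
     (NSet 13 (nvar 30) (nsucc (NGet 13 (nvar 30)))) Skip.

Definition round_prog : cmd :=
  For 30 (nsucc n_)
    (Seq (NSet 13 (nvar 30) (NLit 0)) (For 31 (nsucc B_) round_body)).

(* Widths are positive, so one more block always suffices for one more level. *)
Definition price_body : cmd :=
  If (BLeN (nvar 15) (nvar 30))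
     (Seq (RSet 11 (nvar 30) (RGet 1 (nvar 14)))
          (Seq (nassign 15 (NAdd (nvar 15) (NGet 2 (nvar 14)))) (incr 14)))
     (RSet 11 (nvar 30) (RNat (NLit 0))).

Definition price_prog : cmd :=
  Seq (nassign 14 (NLit 0)) (Seq (nassign 15 (NLit 0)) (For 30 n_ price_body)).

(** The last entry of each array is the stride of the next. *)
Definition strides_prog : cmd :=
  Seq (running_sums 16 (nsucc n_) (nsucc B_))
      (Seq (running_sums 17 (nsucc n_) (NGet 16 (nsucc n_)))
           (running_sums 18 (nsucc n_) (NGet 17 (nsucc n_)))).

Lemma sum_ord_ltS n (F : 'I_n -> nat) (o : 'I_n) :
  (\sum_(i < n | i < o.+1) F i = \sum_(i < n | i < o) F i + F o)%N.
Proof.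
rewrite (bigD1 o) //= addnC; congr (_ + _)%N; apply: eq_bigl => i.
by rewrite ltnS ltn_neqAle andbC.
Qed.

Section Phases.
Variable R : realType.
Implicit Types (s : state R) (n B : nat).

Lemma wp_budget s n (eps : R) :
  nmem s 0 0 = n -> rmem s 0 1 = eps -> 0 < eps ->
  wp budget_prog (20 + (Num.truncn (n%:R / eps)).+1 * 20)%N
    (fun s' => nmem s' 10 0 = Num.truncn (n%:R / eps) + n)%N s.
Proof.
move=> hn he eps0; set N := Num.truncn _.
have ne0 : 0 <= n%:R / eps by rewrite divr_ge0 // ltW.
have testE s' : agree (nmods budget_prog) (rmods budget_prog) s s' ->
    beval s' budget_test = (nmem s' 10 0 < N)%N.
  move=> ag; rewrite /=; trace_back; rewrite hn he addn1.
  by rewrite -ler_pdivlMr // /N -truncn_ge_nat.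
have loop k s' : (k <= N)%N -> agree (nmods budget_prog) (rmods budget_prog) s s' ->
    nmem s' 10 0 = k ->
    wp (While budget_test (incr 10)) ((N - k).+1 * 20)%N (fun s'' => nmem s'' 10 0 = N) s'.
  move: {2}(N - k)%N (erefl (N - k)%N) => m.
  elim: m k s' => [|m IH] k s' Nk kN ags' xk.
    have Ek : k = N by lia.
    apply: (@wp_conseq _ _ (bcost budget_test).+1 _ (fun s'' => nmem s'' 10 0 = N)) => //.
      by apply: wp_while_false; rewrite ?testE // ?xk ?Ek ?ltnn.
  apply: (@wp_conseq _ _ (bcost budget_test + loop_free_time (incr 10)
     + (N - k.+1).+1 * 20).+1 _ (fun s'' => nmem s'' 10 0 = N)) => //; last first.
    by rewrite /=; lia.
  apply: (@wp_while_true _ _ _ _ _ (fun s'' => nmem s'' 10 0 = k.+1)).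
  - by rewrite testE // xk; lia.
  - by apply: wp_run => //=; rewrite /upd /= xk addn1.
  - move=> s'' ag'' x''; apply: IH => //; first by lia.
    + by lia.
    + by apply: agree_trans ags' _; apply: agree_incl ag''.
apply: (@wp_conseq _ _ (3 + ((N - 0).+1 * 20 + loop_free_time (nassign 10 (NAdd B_ n_))))%N _
   (fun s' => nmem s' 10 0 = N + n)%N) => //; last by rewrite subn0 /=; lia.
apply: (@wp_seq _ _ _ _ _ (fun s' => nmem s' 10 0 = 0%N)).
  exact: (@wp_run _ (nassign 10 (NLit 0))).
move=> s1 ag1 h1.
apply: (@wp_seq _ _ _ _ _ (fun s' => nmem s' 10 0 = N)).
  by apply: loop => //; apply: agree_incl ag1.
move=> s2 ag2 h2; apply: wp_run => //=; rewrite /upd /= h2.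
by trace_back; rewrite hn.
Qed.

Lemma wp_sort s n (f : 'I_n -> nat) :
  nmem s 0 0 = n -> (forall c : 'I_n, nmem s 1 c = f c) ->
  wp sort_prog
    (for_time n (3 + (for_time n (loop_free_time rank_body) 2 + 5)) 2)
    (fun s' => forall c : 'I_n, nmem s' 11 (rank f c) = c) s.
Proof.
move=> hn hf.
pose I k s' := forall c : 'I_n, (c < k)%N -> nmem s' 11 (rank f c) = c.
suff : wp sort_prog
    (for_time n (3 + (for_time n (loop_free_time rank_body) 2 + 5)) 2) (I n) s.
  by move/wp_conseq; apply => // s' _ h c; apply: h.
apply: wp_for => //.
- by move=> s' ag /=; trace_back.
move=> k s1 kn ag1 xk Ik.
apply: (@wp_seq _ _ _ _ _ (fun s' => nmem s' 46 0 = 0%N)).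
  exact: (@wp_run _ (nassign 46 (NLit 0))).
move=> s2 ag2 h2.
pose o := Ordinal kn.
pose J k2 s' := nmem s' 46 0 = (\sum_(c < n | c < k2) before f c o)%N.
apply: (@wp_seq _ _ _ _ _ (J n)).
  apply: wp_for => //.
  - by move=> s' ag /=; trace_back.
  - by rewrite /J /= /upd /= h2 big_pred0.
  move=> k2 s3 kn2 ag3 xk2 Jk2; apply: wp_run => //.
  rewrite /J; pose o2 := Ordinal kn2.
  have E30 : nmem s3 30 0 = k by trace_back.
  have E1 c : nmem s3 1 c = nmem s 1 c.
    by trace_back.
  rewrite (sum_ord_ltS _ o2) -Jk2 /= xk2 E30 !E1 (hf o) (hf o2).
  by rewrite -/(before f o2 o); case: (before f o2 o); rewrite /upd /= ?addn0.
move=> s3 ag3 J3; apply: (@wp_run _ (NSet 11 (nvar 46) (nvar 30))) => //.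
have Er : nmem s3 46 0 = rank f o.
  by rewrite J3 /rank; apply: eq_bigl => c; rewrite ltn_ord.
have E30 : nmem s3 30 0 = k by trace_back.
move=> c; rewrite /= /upd /= Er E30; have [->|co] := eqVneq c o.
  by rewrite eqxx.
rewrite ltnS leq_eqVlt => /orP[/eqP ck|ck].
  by case/eqP: co; apply: val_inj.
(* Ranks are distinct, so the write for [o] destroys no earlier entry. *)
case: eqP => [e|_]; last first.
  by trace_back; apply: Ik.
by case/eqP: co; apply: (@rank_ord_inj _ f); apply: val_inj.
Qed.

Definition running_sums_time (N ce cN : nat) : nat :=
  (3 + for_time N (9 + ce) cN)%N.

Lemma wp_running_sums a Ne e N (E : nat -> nat) s : a != 30%N ->
  (forall s', agree [:: a; 30%N] [::] s s' -> neval s' Ne = N) ->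
  (forall k s', (k < N)%N -> agree [:: a; 30%N] [::] s s' ->
     nmem s' 30 0 = k -> neval s' e = E k) ->
  wp (running_sums a Ne e) (running_sums_time N (ncost e) (ncost Ne))
    (fun s' => forall k, (k <= N)%N -> nmem s' a k = \sum_(i < k) E i)%N s.
Proof.
move=> a30 hN he.
apply: (@wp_seq _ _ _ _ _ (fun s' => nmem s' a 0 = 0%N)).
  by apply: (@wp_run _ (NSet a (NLit 0) (NLit 0))) => //=; rewrite /upd !eqxx.
move=> s1 ag1 h1.
have agS s' : agree (nmods (For 30 Ne (NSet a (nsucc (nvar 30)) (NAdd (NGet a (nvar 30)) e))))
   [::] s1 s' -> agree [:: a; 30%N] [::] s s'.
  move=> ag; apply: agree_trans (agree_incl _ _ ag1) (agree_incl _ _ ag) => //=.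
  - by rewrite inE eqxx.
  - by rewrite !inE !eqxx !orbT.
pose I k s' := forall k', (k' <= k)%N -> nmem s' a k' = (\sum_(i < k') E i)%N.
suff : wp (For 30 Ne (NSet a (nsucc (nvar 30)) (NAdd (NGet a (nvar 30)) e)))
  (for_time N (9 + ncost e) (ncost Ne)) (I N) s1 by [].
apply: wp_for => /=.
- by rewrite inE eq_sym.
- by move=> s' /agS; apply: hN.
- by case=> // _; rewrite /= /upd (negPf a30) h1 big_ord0.
move=> k s2 kN /agS ag2 xk Ik.
have -> : (9 + ncost e)%N
   = loop_free_time (NSet a (nsucc (nvar 30)) (NAdd (NGet a (nvar 30)) e)).
  by rewrite /=; lia.
apply: wp_run => //= k' k'k; rewrite /= /upd (negPf a30) eqxx /= xk addn1.
case: eqP => [->|ne]; last by apply: Ik; lia.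
by rewrite big_ord_recr /= Ik // (he k).
Qed.

Lemma wp_sums s n (f : 'I_n -> nat) (sg : nat -> 'I_n) :
  nmem s 0 0 = n -> (forall c : 'I_n, nmem s 1 c = f c) ->
  (forall k, (k < n)%N -> nmem s 11 k = sg k) ->
  wp sums_prog (running_sums_time n 4 2)
    (fun s' => forall v, (v <= n)%N -> nmem s' 12 v = \sum_(k < v) f (sg k))%N s.
Proof.
move=> hn hf hsg; apply: (@wp_running_sums _ _ _ n (fun k => f (sg k))) => //=.
- by move=> s' ag; trace_back.
- by move=> k s' kn ag xk; rewrite xk; trace_back; rewrite hsg // hf.
Qed.

Lemma wp_round s n B (delta : R) (S : nat -> nat) :
  nmem s 0 0 = n -> nmem s 10 0 = B -> rmem s 10 0 = delta ->
  (forall v, (v <= n)%N -> nmem s 12 v = S v) ->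
  wp round_prog
    (for_time n.+1 (4 + for_time B.+1 (loop_free_time round_body) 4) 4)
    (fun s' => forall v, (v <= n)%N ->
       nmem s' 13 v = round_up delta B (S v)%:R) s.
Proof.
move=> hn hB hd hS.
pose I k s' := forall v, (v < k)%N -> nmem s' 13 v = round_up delta B (S v)%:R.
suff : wp round_prog
    (for_time n.+1 (4 + for_time B.+1 (loop_free_time round_body) 4) 4) (I n.+1) s by [].
apply: wp_for => //.
- by move=> s' ag /=; trace_back; rewrite hn addn1.
move=> k s1 kn ag1 xk Ik.
apply: (@wp_seq _ _ _ _ _ (fun s' => I k s' /\ nmem s' 13 k = 0%N)).
  apply: (@wp_run _ (NSet 13 (nvar 30) (NLit 0))) => //.
  split=> [v vk|]; rewrite /= /upd /= xk ?eqxx //.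
  by case: eqP => [e|_]; [lia | apply: Ik].
move=> s2 ag2 [Ik2 h2].
pose J k2 s' := I k s' /\
  nmem s' 13 k = (\sum_(i < k2) ~~ ((S k)%:R <= i%:R * delta)%R)%N.
suff H : wp (For 31 (nsucc B_) round_body)
    (for_time B.+1 (loop_free_time round_body) 4) (J B.+1) s2.
  apply: wp_conseq H _ _ => // s3 _ [I3 J3] v.
  by rewrite ltnS leq_eqVlt => /orP[/eqP->|/I3].
apply: wp_for => //.
- by move=> s' ag /=; trace_back; rewrite hB addn1.
- by split=> //; rewrite big_ord0.
move=> k2 s3 kn2 ag3 xk2 [Ik3 Jk2]; apply: wp_run => //.
have E30 : nmem s3 30 0 = k by trace_back.
have E12 : nmem s3 12 k = S k.
  by trace_back; apply: hS.
have E10 : rmem s3 10 0 = delta.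
  by trace_back.
rewrite /J big_ord_recr -Jk2 /= xk2 E30 E12 E10.
case: (_ <= _); rewrite /= ?addn0; split=> // [v vk|]; rewrite /= /upd /= ?eqxx //.
by case: eqP => [e|_]; [lia | apply: Ik3].
Qed.

Lemma wp_price s n (bs : scheme R) :
  nmem s 0 0 = n -> (forall h, nmem s 2 h = nth 0%N (unzip1 bs) h) ->
  (forall h, rmem s 1 h = nth 0 (unzip2 bs) h) ->
  wp price_prog (6 + for_time n (loop_free_time price_body) 2)%N
    (fun s' => forall d, (d < n)%N -> rmem s' 11 d = level_price bs d) s.
Proof.
move=> hn hw hq.
pose I k s' := [/\ nmem s' 14 0 = blocks_used bs k,
  nmem s' 15 0 = width_upto bs (blocks_used bs k) &
  forall d, (d < k)%N -> rmem s' 11 d = level_price bs d].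
rewrite -[6%N]/(3 + 3)%N -addnA.
apply: (@wp_seq _ _ _ _ _ (fun s' => nmem s' 14 0 = 0%N)).
  exact: (@wp_run _ (nassign 14 (NLit 0))).
move=> s1 ag1 h1.
apply: (@wp_seq _ _ _ _ _ (fun s' => nmem s' 15 0 = 0%N)).
  exact: (@wp_run _ (nassign 15 (NLit 0))).
move=> s2 ag2 h2.
suff H : wp (For 30 n_ price_body) (for_time n (loop_free_time price_body) 2) (I n) s2.
  by apply: wp_conseq H _ _ => // s' _ [].
apply: wp_for => //.
- by move=> s' ag /=; trace_back.
- split=> //; rewrite /= /upd /=; first by trace_back.
  by rewrite h2 width_upto0.
move=> k s3 kn ag3 xk [I1 I2 I3]; apply: wp_run => //.
have Ew h : nmem s3 2 h = nth 0%N (unzip1 bs) h.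
  by trace_back.
have Eq h : rmem s3 1 h = nth 0 (unzip2 bs) h.
  by trace_back.
rewrite /I /= xk I2 /level_price.
case: ifP => hk; split=> [||d dk]; rewrite /= /upd /= ?I1 ?I2 ?addn1 ?width_uptoS ?Ew ?Eq //.
- case: eqP => [->|ne]; first by rewrite hk.
  by apply: I3; lia.
- case: eqP => [->|ne]; first by rewrite hk.
  by apply: I3; lia.
Qed.

Definition strides_time n : nat :=
  (running_sums_time n.+1 4 4 + (running_sums_time n.+1 5 4 + running_sums_time n.+1 5 4))%N.

Lemma wp_strides s n B : nmem s 0 0 = n -> nmem s 10 0 = B ->
  wp strides_prog (strides_time n)
    (fun s' => forall k, (k <= n.+1)%N ->
      [/\ nmem s' 16 k = k * B.+1, nmem s' 17 k = k * (n.+1 * B.+1)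
        & nmem s' 18 k = k * (n.+1 * (n.+1 * B.+1))])%N s.
Proof.
move=> hn hB.
have sumE k c : (\sum_(i < k) c = k * c)%N by rewrite sum_nat_const card_ord.
apply: wp_seq (@wp_running_sums _ _ _ n.+1 (fun=> B.+1) _ _ _ _) _ => //=.
- by move=> s' ag; trace_back; rewrite hn addn1.
- by move=> k s' _ ag _; trace_back; rewrite hB addn1.
move=> s1 ag1 h1; apply: wp_seq (@wp_running_sums _ _ _ n.+1
  (fun=> n.+1 * B.+1)%N _ _ _ _) _ => //=.
- by move=> s' ag; trace_back; rewrite hn addn1.
- move=> k s' _ ag _; trace_back.
  by rewrite hn addn1 h1 // sumE.
move=> s2 ag2 h2; apply: wp_conseq (@wp_running_sums _ _ _ n.+1
  (fun=> n.+1 * (n.+1 * B.+1))%N _ _ _ _) _ _ => //=.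
- by move=> s' ag; trace_back; rewrite hn addn1.
- move=> k s' _ ag _; trace_back.
  by rewrite hn addn1 h2 // sumE.
move=> s3 ag3 h3 k kn; split.
- by trace_back; rewrite h1 // sumE.
- by trace_back; rewrite h2 // sumE.
- by rewrite h3 // sumE.
Qed.

End Phases.

(** * Filling the table and reading off the tree *)

Definition cell_exp (u v j l : nexp) : nexp :=
  NAdd (NAdd (NAdd (NGet 18 u) (NGet 17 v)) (NGet 16 j)) l.

Definition npred (e : nexp) : nexp := NSub e (NLit 1).

Definition leaf_exp : nexp :=
  cell_exp (nvar 30) (npred (nvar 31)) (npred (nvar 32)) (nvar 33).

Definition down_exp : nexp :=
  cell_exp (npred (nvar 30)) (nvar 31) (NAdd (nvar 32) (nvar 32))
           (NSub (nvar 33) (NGet 13 (nvar 31))).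

Definition here_exp : nexp :=
  cell_exp (nvar 30) (nvar 31) (nvar 32) (nvar 33).

Definition down_test : bexp :=
  BAnd (BLeN (NLit 1) (nvar 30))
    (BAnd (BLeN (NAdd (nvar 32) (nvar 32)) (nvar 31))
      (BAnd (BLeN (NGet 13 (nvar 31)) (nvar 33))
            (BLeN (NLit 1) (NGet 21 down_exp)))).

Definition cell_prog : cmd :=
  Seq (nassign 22 (NLit 0)) (Seq (RSet 13 (NLit 0) (RNat (NLit 0)))
  (If (BLeN (nvar 31) (NLit 0))
      (If (BLeN (nvar 32) (NLit 0)) (nassign 22 (NLit 3)) Skip)
  (If (BLeN (nvar 32) (NLit 0)) Skip
  (Seq (If (BLeN (NLit 1) (NGet 21 leaf_exp))
           (Seq (nassign 22 (NLit 1)) (RSet 13 (NLit 0) (RGet 12 leaf_exp)))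
           Skip)
       (If down_test
           (Seq (RSet 14 (NLit 0)
                  (RAdd (RGet 12 down_exp)
                    (RMul (RNat (NGet 12 (nvar 31)))
                          (RGet 11 (NSub n_ (nsucc (nvar 30)))))))
                (If (BAnd (BLeN (NLit 1) (nvar 22))
                          (BLeR (RGet 13 (NLit 0)) (RGet 14 (NLit 0))))
                    Skip
                    (Seq (nassign 22 (NLit 2))
                         (RSet 13 (NLit 0) (RGet 14 (NLit 0))))))
           Skip))))).

Definition write_prog : cmd :=
  Seq (NSet 21 here_exp (nvar 22)) (RSet 12 here_exp (RGet 13 (NLit 0))).

Definition dp_prog : cmd :=
  For 30 n_ (For 31 (nsucc n_) (For 32 (nsucc n_) (For 33 (nsucc B_)
    (Seq cell_prog write_prog)))).

Definition walk_cell : nexp :=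
  NGet 21 (cell_exp (nvar 40) (nvar 41) (nvar 42) (nvar 43)).

Definition walk_test : bexp :=
  BAnd (BLeN (NLit 1) walk_cell) (BLeN walk_cell (NLit 2)).

Definition advance (a k : nat) : cmd := nassign a (NAdd (nvar a) (NLit k)).

Definition walk_leaf : cmd :=
  Seq (NSet 4 (nvar 44) (NLit 0))
  (Seq (NSet 4 (nsucc (nvar 44)) (NGet 11 (npred (nvar 41))))
  (Seq (advance 44 3)
  (Seq (nassign 41 (npred (nvar 41))) (nassign 42 (npred (nvar 42)))))).

(* The nodes are written in breadth-first order into records of size 3, so the
   children of the nodes of a level are the next free records. *)
Definition fill_body : cmd :=
  Seq (NSet 4 (nvar 44) (NLit 1))
  (Seq (NSet 4 (nsucc (nvar 44)) (nvar 45))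
  (Seq (NSet 4 (NAdd (nvar 44) (NLit 2)) (NAdd (nvar 45) (NLit 3)))
  (Seq (advance 45 6) (advance 44 3)))).

Definition next_level : cmd :=
  Seq (nassign 43 (NSub (nvar 43) (NGet 13 (nvar 41))))
  (Seq (nassign 40 (npred (nvar 40)))
       (nassign 42 (NAdd (nvar 42) (nvar 42)))).

Definition walk_down : cmd := Seq (For 30 (nvar 42) fill_body) next_level.

Definition walk_body : cmd :=
  If (BLeN walk_cell (NLit 1)) walk_leaf walk_down.

Definition walk_init : cmd :=
  Seq (nassign 3 (NLit 0))
  (Seq (nassign 40 (npred n_))
  (Seq (nassign 41 n_)
  (Seq (nassign 42 (NLit 1))
  (Seq (nassign 43 B_)
  (Seq (nassign 44 (NLit 0)) (nassign 45 (NLit 3))))))).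

Definition walk_prog : cmd := Seq walk_init (While walk_test walk_body).

Lemma radix_ltn (m a b a' b' : nat) :
  (a < a')%N -> (b < m)%N -> (a * m + b < a' * m + b')%N.
Proof.
move=> aa bm; have : (a.+1 * m <= a' * m)%N by rewrite leq_mul2r aa orbT.
by rewrite mulSn; lia.
Qed.

Lemma radix_inj (m a b a' b' : nat) : (b < m)%N -> (b' < m)%N ->
  (a * m + b = a' * m + b')%N -> a = a' /\ b = b'.
Proof.
move=> bm bm' e; have m0 : (0 < m)%N by lia.
have [] := ltngtP a a'.
- by move=> /(@radix_ltn m a b a' b')/(_ bm); lia.
- by move=> /(@radix_ltn m a' b' a b)/(_ bm'); lia.
- by move=> ea; rewrite ea in e *; split=> //; lia.
Qed.

Section Table.
Variables (R : realType) (n B : nat) (S r : nat -> nat) (g : nat -> R).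
Implicit Type s : state R.

(** A mixed-radix numeral: addresses follow the lexicographic order of the four nested loops, so a
    single bound in [table_ok] describes the part already filled. *)
Definition address (u v j l : nat) : nat :=
  (((u * n.+1 + v) * n.+1 + j) * B.+1 + l)%N.

Definition in_table (u v j l : nat) : bool :=
  [&& u < n, v <= n, j <= n & l <= B]%N.

Local Notation dp := (dp n S r g).

Definition table_ok s X : Prop :=
  forall u v j l, in_table u v j l -> (address u v j l < X)%N ->
    nmem s 21 (address u v j l) = (dp u v j l).1 /\
    rmem s 12 (address u v j l) = (dp u v j l).2.

Record env s : Prop := Env {
  env_n : nmem s 0 0 = n;
  env_B : nmem s 10 0 = B;
  env_S : forall v, (v <= n)%N -> nmem s 12 v = S v;
  env_r : forall v, (v <= n)%N -> nmem s 13 v = r v;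
  env_g : forall d, (d < n)%N -> rmem s 11 d = g d;
  env_stride : forall k, (k <= n.+1)%N ->
    [/\ nmem s 16 k = k * B.+1, nmem s 17 k = k * (n.+1 * B.+1)
      & nmem s 18 k = k * (n.+1 * (n.+1 * B.+1))]%N
}.

Lemma env_agree A Bm s s' : agree A Bm s s' ->
  all [predC A] [:: 0; 10; 12; 13; 16; 17; 18]%N -> 11%N \notin Bm ->
  env s -> env s'.
Proof.
move=> [h1 h2] /=.
case/and5P=> a0 a10 a12 a13 /and4P[a16 a17 a18 _] a11 [e1 e2 e3 e4 e5 e6].
split.
- by rewrite h1.
- by rewrite h1.
- by move=> v; rewrite h1 //; apply: e3.
- by move=> v; rewrite h1 //; apply: e4.
- by move=> v; rewrite h2 //; apply: e5.
- by move=> v; rewrite !h1 //; apply: e6.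
Qed.

Lemma table_ok_agree A Bm s s' X : agree A Bm s s' ->
  21%N \notin A -> 12%N \notin Bm -> table_ok s X -> table_ok s' X.
Proof.
move=> [h1 h2] a21 a12 h u v j l i X'; rewrite h1 // h2 //; exact: h.
Qed.

Lemma address_inj u v j l u' v' j' l' : in_table u v j l ->
  in_table u' v' j' l' -> address u v j l = address u' v' j' l' ->
  [/\ u = u', v = v', j = j' & l = l'].
Proof.
move=> /and4P[_ vn jn lB] /and4P[_ vn' jn' lB'].
case/(@radix_inj B.+1) => // /(@radix_inj n.+1)[] // /(@radix_inj n.+1)[] //.
Qed.

Lemma address_leaf u v j l : (0 < v)%N -> (0 < j)%N -> (l <= B)%N ->
  (address u v.-1 j.-1 l < address u v j l)%N.
Proof.
move=> v0 j0 lB; apply: radix_ltn; last by rewrite ltnS.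
by rewrite -addnS prednK // leq_add2r leq_mul2r leq_add2l leq_pred orbT.
Qed.

(** The drop of the leading digit outweighs the doubling of [j], which the guard [j + j <= v] keeps
    a valid digit. *)
Lemma address_down u v j l l' : (0 < u)%N -> (j + j <= n)%N -> (l' <= B)%N ->
  (address u.-1 v (j + j) l' < address u v j l)%N.
Proof.
move=> u0 jn lB; apply: radix_ltn; last by rewrite ltnS.
apply: radix_ltn; last by rewrite ltnS.
by rewrite -{2}(prednK u0) mulSn; lia.
Qed.

Lemma cell_expE s eu ev ej el u v j l : env s ->
  neval s eu = u -> neval s ev = v -> neval s ej = j -> neval s el = l ->
  (u <= n.+1)%N -> (v <= n.+1)%N -> (j <= n.+1)%N ->
  neval s (cell_exp eu ev ej el) = address u v j l.
Proof.
move=> es /= -> -> -> -> un vn jn.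
have [_ _ ->] := env_stride es un; have [_ -> _] := env_stride es vn.
have [-> _ _] := env_stride es jn.
by rewrite /address !mulnDl !mulnA.
Qed.

(** [run_cell_prog] feeds [dp_cell] whatever the two successor addresses contain; agreement is
    needed only where [dp_cell] consults them. *)
Lemma dp_cell_ext S1 r1 g1 u v j l (A1 B1 A2 B2 : nat * R) :
  S1 v = S v -> r1 v = r v -> g1 (n - u.+1)%N = g (n - u.+1)%N ->
  ((0 < v)%N -> (0 < j)%N -> A1 = A2) ->
  ((0 < u)%N -> (0 < j)%N -> (j + j <= v)%N -> (r v <= l)%N -> B1 = B2) ->
  dp_cell n S1 r1 g1 u v j l A1 B1 = dp_cell n S r g u v j l A2 B2.
Proof.
move=> hS hr hg hA hB; rewrite /dp_cell hS hr hg.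
case: v hA hB {hS hr} => [|v] hA hB //=; case: j hA hB => [|j] hA hB //=.
rewrite hA //; case: (ltnP 0 u) => //= u0; case: (leqP (j.+1 + j.+1)%N v.+1) => //= jv.
by case: (leqP (r v.+1) l) => //= rl; rewrite hB.
Qed.

Lemma run_cell_prog s :
  let u := nmem s 30 0 in let v := nmem s 31 0 in
  let j := nmem s 32 0 in let l := nmem s 33 0 in
  let A := (nmem s 21 (neval s leaf_exp), rmem s 12 (neval s leaf_exp)) in
  let D := (nmem s 21 (neval s down_exp), rmem s 12 (neval s down_exp)) in
  (nmem (run cell_prog s) 22 0, rmem (run cell_prog s) 13 0)
  = dp_cell (nmem s 0 0) (nmem s 12) (nmem s 13) (rmem s 11) u v j l A D.
Proof.
move=> u v j l A D.
(* [s1] follows the reset and [s3] the leaf alternative; [s4] has the cost of a descent added, and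
   [s5] adopts the descent. *)
set s1 := run (Seq (nassign 22 (NLit 0)) (RSet 13 (NLit 0) (RNat (NLit 0)))) s.
set s2 := run (Seq (nassign 22 (NLit 1)) (RSet 13 (NLit 0) (RGet 12 leaf_exp))) s1.
set x := D.2 + (nmem s 12 v)%:R * rmem s 11 (nmem s 0 0 - u.+1)%N.
pose s3 := if (1 <= A.1)%N then s2 else s1.
pose s4 := State (nmem s3) (upd (rmem s3) 14 0 x).
pose s5 := run (Seq (nassign 22 (NLit 2)) (RSet 13 (NLit 0) (RGet 14 (NLit 0)))) s4.
pose bd := [&& (1 <= u)%N, (j + j <= v)%N, (nmem s 13 v <= l)%N & (1 <= D.1)%N].
have s3E : [/\ beval s3 down_test = bd, nmem s3 22 0 = (1 <= A.1)%N,
   rmem s3 13 0 = (if (1 <= A.1)%N then A.2 else 0) &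
   reval s3 (RAdd (RGet 12 down_exp) (RMul (RNat (NGet 12 (nvar 31)))
                          (RGet 11 (NSub n_ (nsucc (nvar 30)))))) = x].
  rewrite /x -[u.+1]addn1 /s3; case: ifP => _; by split.
case: s3E => bdE n3 r3 xE.
have -> : run cell_prog s =
  if (v <= 0)%N then (if (j <= 0)%N then run (nassign 22 (NLit 3)) s1 else s1)
  else if (j <= 0)%N then s1 else
  if bd then
    if (1 <= nmem s3 22 0)%N && (rmem s3 13 0 <= x) then s4 else s5
  else s3.
  by rewrite -bdE /s5 /s4 -xE.
rewrite /dp_cell; case: ifP => _; first by case: ifP.
case: ifP => _; first by [].
rewrite -/bd -/x; case: bd {bdE}.
  rewrite n3 r3 lt0b; case: (ltnP 0 A.1) => hA /=; last by [].
  case: ifP => _; last by [].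
  by rewrite /s4 /= /upd /= n3 hA r3 hA.
by rewrite n3 r3; case: (ltnP 0 A.1).
Qed.

Lemma table_step s u v j l : in_table u v j l -> env s ->
  nmem s 30 0 = u -> nmem s 31 0 = v -> nmem s 32 0 = j -> nmem s 33 0 = l ->
  table_ok s (address u v j l) ->
  wp (Seq cell_prog write_prog)
    (loop_free_time cell_prog + loop_free_time write_prog)
    (fun s' => table_ok s' (address u v j l).+1) s.
Proof.
move=> it es hu hv hj hl ok; case/and4P: (it) => un vn jn lB.
apply: (@wp_seq _ _ _ _ _ (fun s' => nmem s' 22 0 = (dp u v j l).1 /\
    rmem s' 13 0 = (dp u v j l).2)).
  apply: wp_run => //.
  suff -> : dp u v j l = (nmem (run cell_prog s) 22 0, rmem (run cell_prog s) 13 0) by [].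
  rewrite run_cell_prog (env_n es) hu hv hj hl dpE; apply/esym/dp_cell_ext.
  - exact: (env_S es).
  - exact: (env_r es).
  - by apply: (env_g es); lia.
  - move=> v0 j0; rewrite (@cell_expE _ _ _ _ _ u v.-1 j.-1 l) //=; try lia.
    + have [||-> ->] := ok u v.-1 j.-1 l; last by case: (dp _ _ _ _).
        by rewrite /in_table un lB; lia.
      exact: address_leaf.
  - move=> u0 j0 jv rl; rewrite (@cell_expE _ _ _ _ _ u.-1 v (j + j)%N (l - r v)%N) //=; try lia.
    + have [||-> ->] := ok u.-1 v (j + j)%N (l - r v)%N; last by case: (dp _ _ _ _).
        by rewrite /in_table; lia.
      by apply: address_down => //; lia.
    + by rewrite hl hv (env_r es).
move=> s1 ag1 [h1 h2].
have es1 : env s1 by apply: env_agree ag1 _ _ es.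
have ok1 : table_ok s1 (address u v j l) by apply: table_ok_agree ag1 _ _ ok.
apply: wp_run => //.
have E1 : neval s1 here_exp = address u v j l.
  by apply: cell_expE => //=; try lia; trace_back.
have -> : run write_prog s1 =
  State (upd (nmem s1) 21 (neval s1 here_exp) (nmem s1 22 0))
        (upd (rmem s1) 12 (neval s1 here_exp) (rmem s1 13 0)) by [].
rewrite E1 h1 h2 => u' v' j' l' it'; rewrite ltnS leq_eqVlt /= /upd !eqxx /=.
case/orP => [/eqP e|lt]; last first.
  by rewrite (ltn_eqF lt); apply: ok1.
by have [-> -> -> ->] := address_inj it' it e; rewrite eqxx.
Qed.

Definition dp_time : nat :=
  for_time n (for_time n.+1 (for_time n.+1 (for_time B.+1
    (loop_free_time cell_prog + loop_free_time write_prog) 4) 4) 4) 2.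

Lemma wp_dp s : env s ->
  wp dp_prog dp_time (fun s' => table_ok s' (address n 0 0 0)) s.
Proof.
move=> es.
apply: (@wp_for _ _ _ _ n _ (fun k s' => table_ok s' (address k 0 0 0))) => //.
  by move=> s' ag /=; trace_back; apply: env_n.
move=> u s1 un ag1 hu ok1.
have es1 : env s1 by apply: env_agree ag1 _ _ es.
(* A carry: a completed inner loop ends where the next round of the outer one begins. *)
have -> : address u.+1 0 0 0 = address u n.+1 0 0 by rewrite /address mulSn; lia.
apply: (@wp_for _ _ _ _ n.+1 _ (fun k s' => table_ok s' (address u k 0 0))) => //.
  by move=> s' ag /=; trace_back; rewrite (env_n es) addn1.
move=> v s2 vn ag2 hv ok2.
have es2 : env s2 by apply: env_agree ag2 _ _ es1.
have -> : address u v.+1 0 0 = address u v n.+1 0.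
  by rewrite /address !addnS mulSn; lia.
apply: (@wp_for _ _ _ _ n.+1 _ (fun k s' => table_ok s' (address u v k 0))) => //.
  by move=> s' ag /=; trace_back; rewrite (env_n es) addn1.
move=> j s3 jn ag3 hj ok3.
have es3 : env s3 by apply: env_agree ag3 _ _ es2.
have -> : address u v j.+1 0 = address u v j B.+1.
  by rewrite /address !addnS mulSn; lia.
apply: (@wp_for _ _ _ _ B.+1 _ (fun k s' => table_ok s' (address u v j k))) => //.
  by move=> s' ag /=; trace_back; rewrite (env_B es) addn1.
move=> l s4 lB ag4 hl ok4.
have es4 : env s4 by apply: env_agree ag4 _ _ es3.
have := @table_step s4 u v j l; rewrite -addnS; apply => //.
- by rewrite /in_table; lia.
- by trace_back.
- by trace_back.
- by trace_back.
Qed.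

End Table.

(** * Writing the tree in breadth-first order *)

Section Walk.
Variables (R : realType) (n B : nat) (S r : nat -> nat) (g : nat -> R).
Variable sg : nat -> 'I_n.
Implicit Type s : state R.

Local Notation dp := (dp n S r g).
Local Notation dp_forest := (dp_forest sg S r g).

Lemma wp_fill s p a j : nmem s 42 0 = j ->
  nmem s 44 0 = (3 * p)%N -> nmem s 45 0 = (3 * a)%N ->
  wp (For 30 (nvar 42) fill_body)
    (for_time j (loop_free_time fill_body) 2)
    (fun s' => [/\ nmem s' 44 0 = 3 * (p + j), nmem s' 45 0 = 3 * (a + (j + j)),
      forall X, X < 3 * p -> nmem s' 4 X = nmem s 4 X &
      forall k, k < j -> [/\ nmem s' 4 (3 * (p + k)) = 1,
         nmem s' 4 (3 * (p + k)).+1 = 3 * (a + (k + k)) &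
         nmem s' 4 (3 * (p + k)).+2 = 3 * (a + (k + k).+1)]])%N s.
Proof.
move=> hj hp ha.
pose I m s' := [/\ nmem s' 44 0 = 3 * (p + m), nmem s' 45 0 = 3 * (a + (m + m)),
      forall X, X < 3 * p -> nmem s' 4 X = nmem s 4 X &
      forall k, k < m -> [/\ nmem s' 4 (3 * (p + k)) = 1,
         nmem s' 4 (3 * (p + k)).+1 = 3 * (a + (k + k)) &
         nmem s' 4 (3 * (p + k)).+2 = 3 * (a + (k + k).+1)]]%N.
apply: (@wp_for _ _ _ _ j _ I) => //.
- by move=> s' ag /=; trace_back.
- by split=> //=; rewrite /upd /= ?addn0.
move=> m s1 mj ag1 hm [I1 I2 I3 I4]; apply: wp_run => //.
rewrite /I /= /upd /= I1 I2; split; try lia.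
- move=> X Xp; rewrite -I3 //.
  by rewrite !ifF //; lia.
- move=> k; rewrite ltnS leq_eqVlt => /orP[/eqP ->|km].
    split; rewrite ?eqxx; repeat case: eqP => ?; lia.
  have [J1 J2 J3] := I4 k km.
  by split; rewrite ?J1 ?J2 ?J3 !ifF //; lia.
Qed.

Definition step_time : nat :=
  (bcost (BLeN walk_cell (NLit 1)) + (loop_free_time walk_leaf
    + (for_time n (loop_free_time fill_body) 2 + loop_free_time next_level))).+1.

Definition walk_time : nat :=
  (loop_free_time walk_init
   + (n + n).+1 * (bcost walk_test + step_time + 2))%N.

(** Records [p] to [p + j - 1] are reserved for the undecided nodes of the level, and those from
    [p + j] on are free. Each step lowers [u + v], which bounds the time even from an infeasible
    cell; records below [p] are final. *)
Lemma wp_walk_loop t0 u v j l s p : in_table n B u v j l -> env n B S r g s ->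
  table_ok n B S r g s (address n B n 0 0 0) ->
  (forall k, (k < n)%N -> nmem s 11 k = sg k) ->
  nmem s 40 0 = u -> nmem s 41 0 = v -> nmem s 42 0 = j -> nmem s 43 0 = l ->
  nmem s 44 0 = (3 * p)%N -> nmem s 45 0 = (3 * (p + j))%N ->
  wp (While walk_test walk_body)
    ((u + v).+1 * (bcost walk_test + step_time + 2))%N
    (fun s' => (0 < (dp u v j l).1)%N ->
       (forall X, X < 3 * p -> nmem s' 4 X = nmem s 4 X)%N /\
       (forall k, (k < j)%N ->
          stored (nmem s' 4) (3 * (p + k))%N (nth t0 (dp_forest u v j l) k))) s.
Proof.
set T := (bcost walk_test + step_time + 2)%N.
have [m] := ubnP (u + v)%N; elim: m u v j l s p => // m IH u v j l s p uvm it es ok hsg.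
move=> hu hv hj hl hp ha; case/and4P: (it) => un vn jn lB.
have lt_end u' v' j' l' : in_table n B u' v' j' l' ->
    (address n B u' v' j' l' < address n B n 0 0 0)%N.
  move=> /and4P[un' vn' jn' lB']; do 3 (apply: radix_ltn => //).
have cellE : neval s walk_cell = (dp u v j l).1.
  rewrite /walk_cell [LHS]/= -[X in nmem s 21 X]/(neval s
    (cell_exp (nvar 40) (nvar 41) (nvar 42) (nvar 43))).
  rewrite (@cell_expE _ _ _ _ _ _ _ _ _ _ _ u v j l es) //; try lia.
  by case: (ok u v j l it (lt_end _ _ _ _ it)).
have testE : beval s walk_test = (0 < (dp u v j l).1 <= 2)%N.
  by rewrite -cellE.
have [c [F [Ec EF H]]] : exists c F, [/\ dp u v j l = c, dp_forest u v j l = F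
    & dp_spec sg S r g u v j l c F].
  by exists (dp u v j l), (dp_forest u v j l); split=> //; apply: dpP.
rewrite Ec EF in cellE testE *.
have small (Q : state R -> Prop) : ~~ beval s walk_test -> Q s ->
    wp (While walk_test walk_body) ((u + v).+1 * T) Q s.
  move=> h1 h2; apply: wp_conseq (wp_while_false walk_body h1 h2) _ _ => //.
case: H Ec EF cellE testE => [|v0 j0|v' j' c' ev ej hf _|u' c' eu j0 jv rl hf _] Ec EF cellE testE.
- by apply: small; rewrite ?testE.
- by apply: small; rewrite ?testE // j0; split.
- have stepT : (bcost walk_test + step_time + (u + v').+1 * T < (u + v).+1 * T)%N.
    by rewrite ev addnS [X in (_ < X)%N]mulSn ltn_add2r /T addn2 ltnW.
  apply: wp_conseq stepT _; last by move=> s' _ h; exact: h.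
  apply: (@wp_while_true _ _ _ _ _ (fun s1 => [/\
      [/\ nmem s1 40 0 = u, nmem s1 43 0 = l & nmem s1 45 0 = nmem s 45 0],
      nmem s1 41 0 = v' /\ nmem s1 42 0 = j',
      nmem s1 44 0 = 3 * p.+1, nmem s1 4 (3 * p) = 0 /\ nmem s1 4 (3 * p).+1 = sg v' &
      forall X, X < 3 * p -> nmem s1 4 X = nmem s 4 X])%N).
  + by rewrite testE.
  + apply: wp_if; last by rewrite -[beval _ _]/(neval s walk_cell <= 1)%N cellE.
    move=> _; apply: wp_conseq (@wp_run _ walk_leaf (eq^~ (run walk_leaf s)) _
      isT (erefl (run walk_leaf s))) _ _.
      exact: leq_addr.
    move=> s1 _ ->; rewrite /= /upd /= hv hp hj ev ej hsg; last by lia.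
    rewrite subn1 /=; split=> //; try lia; last first.
      by move=> X Xp; rewrite !ifF //; lia.
    by rewrite addn1 !eqxx ifF ?eqxx //; lia.
  + move=> s1 ag1 [[e40 e43 e45] [e41 e42] e44 [h0 h1] hX].
    have {}IH := IH u v' j' l s1 p.+1.
    apply: wp_conseq (IH _ _ _ _ _ _ _ _ _ _ _) (leqnn _) _ => //.
    * by lia.
    * by rewrite /in_table; lia.
    * by apply: env_agree ag1 _ _ es.
    * by apply: table_ok_agree ag1 _ _ ok.
    * by move=> k kn; trace_back; apply: hsg.
    * by rewrite e45 ha ej; lia.
    move=> s2 _ Q2 _; have [Q3 Q4] := Q2 hf; split=> [X Xp|k].
      by rewrite Q3 ?hX //; lia.
    rewrite ej; case: k => [|k] kj /=.
      by rewrite addn0 !Q3 ?h0 ?h1 //; lia.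
    by rewrite addnS -addSn; apply: Q4.
- have stepT : (bcost walk_test + step_time + (u' + v).+1 * T < (u + v).+1 * T)%N.
    by rewrite eu addSn [X in (_ < X)%N]mulSn ltn_add2r /T addn2 ltnW.
  apply: wp_conseq stepT _; last by move=> s' _ h; exact: h.
  apply: (@wp_while_true _ _ _ _ _ (fun s1 => [/\
      [/\ nmem s1 40 0 = u', nmem s1 41 0 = v, nmem s1 42 0 = j + j
        & nmem s1 43 0 = l - r v],
      nmem s1 44 0 = 3 * (p + j) /\ nmem s1 45 0 = 3 * (p + j + (j + j)),
      forall X, X < 3 * p -> nmem s1 4 X = nmem s 4 X &
      forall k, k < j -> [/\ nmem s1 4 (3 * (p + k)) = 1,
         nmem s1 4 (3 * (p + k)).+1 = 3 * (p + j + (k + k)) &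
         nmem s1 4 (3 * (p + k)).+2 = 3 * (p + j + (k + k).+1)]])%N).
  + by rewrite testE.
  + apply: wp_if; first by rewrite -[beval _ _]/(neval s walk_cell <= 1)%N cellE.
    move=> _; apply: (@wp_conseq _ _ (for_time j (loop_free_time fill_body) 2
      + loop_free_time next_level)%N) (_ : _ <= _)%N (fun s' _ h => h); last first.
      by apply: leq_trans (leq_addl _ _); rewrite leq_add2r leq_mul2r ltnS jn orbT.
    apply: wp_seq (wp_fill hj hp ha) _ => s1 ag1 [f44 f45 fX fk].
    apply: wp_run => //=; rewrite /upd /=; split=> //.
      trace_back; rewrite hu hv hj hl eu (env_r es) //; split=> //; lia.
  + move=> s1 ag1 [[e40 e41 e42 e43] [e44 e45] hX hk].
    have {}IH := IH u' v (j + j)%N (l - r v)%N s1 (p + j)%N.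
    apply: wp_conseq (IH _ _ _ _ _ _ _ _ _ _ _) (leqnn _) _ => //.
    * by lia.
    * by rewrite /in_table; lia.
    * by apply: env_agree ag1 _ _ es.
    * by apply: table_ok_agree ag1 _ _ ok.
    * by move=> k kn; trace_back; apply: hsg.
    move=> s2 _ Q2 _; have [Q3 Q4] := Q2 hf; split=> [X Xp|k kj].
      by rewrite Q3 ?hX //; lia.
    rewrite (nth_pair_up _ (size_dp_forest sg hf) kj) /=.
    have [k1 k2 k3] := hk k kj.
    rewrite !Q3; try lia.
    by rewrite k1 k2 k3; split=> //; apply: Q4; lia.
Qed.

Lemma wp_walk t0 s : (0 < n)%N -> env n B S r g s ->
  table_ok n B S r g s (address n B n 0 0 0) ->
  (forall k, (k < n)%N -> nmem s 11 k = sg k) ->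
  wp walk_prog walk_time
    (fun s' => (0 < (dp n.-1 n 1 B).1)%N ->
       output s' (nth t0 (dp_forest n.-1 n 1 B) 0)) s.
Proof.
move=> n0 es ok hsg.
apply: wp_seq (@wp_run _ walk_init (eq^~ (run walk_init s)) _ isT (erefl (run walk_init s))) _.
move=> s1 ag1 e1.
have n3 : nmem s1 3 0 = 0%N by rewrite e1.
have H : wp (While walk_test walk_body) ((n.-1 + n).+1 * (bcost walk_test + step_time + 2))%N
    (fun s' => (0 < (dp n.-1 n 1 B).1)%N ->
       (forall X, X < 3 * 0 -> nmem s' 4 X = nmem s1 4 X)%N /\
       (forall k, (k < 1)%N ->
          stored (nmem s' 4) (3 * (0 + k))%N (nth t0 (dp_forest n.-1 n 1 B) k))) s1.
  apply: wp_walk_loop => //.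
  - by rewrite /in_table; lia.
  - by apply: env_agree ag1 _ _ es.
  - by apply: table_ok_agree ag1 _ _ ok.
  - by move=> k kn; trace_back; apply: hsg.
  - by rewrite e1 /= /upd /= (env_n es) subn1.
  - by rewrite e1 /= /upd /= (env_n es).
  - by rewrite e1.
  - by rewrite e1 /= /upd /= (env_B es).
  - by rewrite e1.
  - by rewrite e1.
apply: wp_conseq H _ _.
  by rewrite leq_mul2r ltnS leq_add2r leq_pred orbT.
move=> s2 ag2 H2 /H2[_ /(_ 0%N isT)]; rewrite /output.
by trace_back; rewrite n3.
Qed.

End Walk.

(** * Correctness and running time *)

Section Approximation.
Variables (R : realType) (n : nat) (f : 'I_n -> nat) (bs : scheme R).
Variables (L eps : R).
Hypotheses (n0 : (0 < n)%N) (bs_valid : valid_scheme bs) (eps0 : 0 < eps).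

Let sg := by_freq f (Ordinal n0).
Let S v := (\sum_(k < v) f (sg k))%N.
Let delta : R := eps * L / n%:R.
Let B := (Num.truncn (n%:R / eps) + n)%N.
Let r v := round_up delta B (S v)%:R.
Let g := level_price bs.

Lemma lenE (T : btree 'I_n) : prefix_tree T ->
  (len f T)%:R = forest_weight f (fun d => d%:R) 0 [:: T] :> R.
Proof.
move=> pT; rewrite /forest_weight big_seq1 -prefix_tree_weight // /len natr_sum.
by apply: eq_bigr => c _; rewrite natrM.
Qed.

Lemma decode_timeE (T : btree 'I_n) : prefix_tree T ->
  decode_time f bs T = forest_weight f (block_cost bs) 0 [:: T].
Proof.
by move=> pT; rewrite /forest_weight big_seq1 -prefix_tree_weight.
Qed.

Lemma dp_approx : (exists T0 : btree 'I_n, admissible f L T0) ->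
  (0 < (dp n S r g n.-1 n 1 B).1)%N /\
  forall t0, let T := nth t0 (dp_forest sg S r g n.-1 n 1 B) 0 in
  exists dopt : R,
    [/\ prefix_tree T, (len f T)%:R <= (1 + eps) * L,
        is_DOPT f bs L dopt & decode_time f bs T <= dopt].
Proof.
move=> exT0; have [dopt hdopt] := dopt_exists bs exT0.
have L0 : 0 <= L by case: exT0 => T0 [_]; apply: le_trans.
have d0 : 0 <= delta by rewrite divr_ge0 ?mulr_ge0 // ltW.
have S0 : S 0 = 0%N by rewrite /S big_ord0.
have r0 : r 0 = 0%N by rewrite /r S0 round_up0.
have nR : 0 < n%:R :> R by rewrite ltr0n.
have un : (n.-1 < n)%N by rewrite prednK.
have E0 : (n - n.-1.+1 = 0)%N by rewrite prednK // subnn.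
have gS := block_costS bs_valid; have g0 := level_price_ge0 bs_valid.
(* [T1] attains the optimum and is the competitor of the tree in the table. *)
case: (hdopt) => -[T1 [pT1 lT1] dT1] _.
have sz : size (forest_leaves [:: T1]) = n.
  by rewrite /forest_leaves /= cats0 (perm_size pT1) size_enum_ord.
have uq : uniq (forest_leaves [:: T1]).
  by rewrite /forest_leaves /= cats0 (perm_uniq pT1) enum_uniq.
have szu : (size (forest_leaves [:: T1]) <= size [:: T1] + n.-1)%N.
  by rewrite sz /= add1n prednK.
have cost1 (Q g' : nat -> R) : Q 0%N = 0 -> (forall d, Q d.+1 = Q d + g' d) ->
    (forall d, 0 <= g' d) ->
    level_cost S g' n.-1 [:: T1] <= forest_weight f Q 0 [:: T1].
  move=> Q0 QS g'0.
  have := @level_cost_le _ _ f sg S g' (fun=> erefl) (@by_freq_sorted _ f _)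
    (by_freq_perm f _) Q n.-1 [:: T1] un QS g'0 uq szu.
  by rewrite E0 Q0 mul0r add0r.
have len1 : level_cost S (fun=> 1 : R) n.-1 [:: T1] <= L.
  apply: le_trans lT1; rewrite lenE //; apply: cost1 => // d.
  by rewrite natr1.
have budget : (rounded_length r n.-1 [:: T1] <= B)%N.
  move: L0; rewrite le_eqVlt => /orP[/eqP L0|L0].
    by rewrite (@rounded_length_eq0 _ _ _ d0) // L0.
  have d1 : 0 < delta by rewrite divr_gt0 // mulr_gt0.
  have := rounded_length_le B d0 S n.-1 [:: T1].
  set m := rounded_length _ _ _ => hm.
  have {}hm : delta * m%:R <= L + delta * (n.-1)%:R.
    by apply: le_trans hm _; rewrite lerD2r.
  (* Dividing [hm] by [delta], where [L / delta = n / eps], gives [m - n <= n / eps]. *)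
  have [mn|nm] := leqP m n; first exact: leq_trans mn (leq_addl _ _).
  have ne0 : 0 <= n%:R / eps by rewrite divr_ge0 // ltW.
  rewrite /B addnC -leq_subLR truncn_ge_nat // natrB ?(ltnW nm) //.
  have -> : n%:R / eps = L / delta.
    rewrite /delta; field; rewrite !gt_eqF //.
  rewrite ler_pdivlMr // mulrBl [m%:R * _]mulrC lerBlDr.
  apply: le_trans hm _; rewrite lerD2l mulrC ler_wpM2r // ler_nat; lia.
have [feas val_le] := dp_complete g r0 S0 szu budget.
rewrite sz /= in feas val_le; split=> // t0 T.
have szF := size_dp_forest sg feas.
have EF : dp_forest sg S r g n.-1 n 1 B = [:: T].
  by move: szF; rewrite /T; case: (dp_forest _ _ _ _ _ _ _ _) => [|? []].
have SS v : S v.+1 = (S v + f (sg v))%N by rewrite /S big_ord_recr.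
have pT : prefix_tree T.
  have := forest_leaves_dp sg feas; rewrite EF /forest_leaves /= cats0 => h.
  exact: perm_trans h (by_freq_perm f _).
exists dopt; split=> //.
- rewrite lenE // -EF.
  have := @dp_length _ _ f sg S r g S0 SS delta B n.-1 n 1 B
    (fun v => @le_round_up _ _ _ d0 _) d0 un (leqnn _) feas.
  rewrite E0 mul0r add0r => /le_trans; apply.
  have t1 : (Num.truncn (n%:R / eps))%:R <= n%:R / eps.
    by rewrite truncn_le divr_ge0 // ltW.
  (* Here [delta * (n / eps)] is [L], and the rounding allowance [delta * n] is [eps * L]. *)
  rewrite /B natrD; apply: (@le_trans _ _ (delta * (n%:R / eps + n%:R))).
    by rewrite ler_wpM2l // lerD2r.
  rewrite le_eqVlt; apply/orP; left; apply/eqP.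
  by rewrite /delta; field; rewrite !gt_eqF.
- rewrite decode_timeE // -EF.
  have := dp_cost S0 SS un gS feas.
  rewrite E0 block_cost0 // mul0r add0r => ->.
  rewrite -dT1 decode_timeE //; apply: le_trans val_le _.
  by apply: cost1 => //; apply: block_cost0.
Qed.

End Approximation.

(** * The whole program and its running time *)

Definition main_prog : cmd :=
  Seq budget_prog (Seq unit_prog (Seq sort_prog (Seq sums_prog
  (Seq round_prog (Seq price_prog (Seq strides_prog
  (Seq dp_prog walk_prog))))))).

Definition big_O (T W : nat -> nat -> nat) : Prop :=
  exists K, forall n B, (0 < n)%N -> (T n B <= K * W n B)%N.

Lemma big_O_const c : big_O (fun _ _ => c) (fun _ _ => 1%N).
Proof. by exists c => n B _; rewrite muln1. Qed.

Lemma big_O_add T1 T2 W : big_O T1 W -> big_O T2 W ->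
  big_O (fun n B => T1 n B + T2 n B)%N W.
Proof.
move=> [K1 h1] [K2 h2]; exists (K1 + K2)%N => n B n0.
by rewrite mulnDl leq_add ?h1 ?h2.
Qed.

Lemma big_O_le T W W' :
  (forall n B, (0 < n)%N -> (W n B <= W' n B)%N) -> big_O T W -> big_O T W'.
Proof.
move=> hW [K h]; exists K => n B n0; apply: leq_trans (h n B n0) _.
by rewrite leq_mul2l hW ?orbT.
Qed.

(** The factor 3 covers the final test even for loops of [n + 1] rounds, as [n + 2 <= 3n]. *)
Lemma big_O_for N N' T W ce :
  (forall n B, (0 < n)%N -> (N n B < 3 * N' n B)%N) ->
  (forall n B, (0 < n)%N -> (0 < W n B)%N) -> big_O T W ->
  big_O (fun n B => for_time (N n B) (T n B) ce) (fun n B => N' n B * W n B)%N.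
Proof.
move=> hN hW [K h]; exists (3 * (K + ce + 20))%N => n B n0.
rewrite /for_time mulnACA leq_mul ?hN // !mulnDl -!addnA leq_add ?h //.
by rewrite leq_add // -{1}[X in (X <= _)%N]muln1 leq_mul2l hW ?orbT.
Qed.

Definition main_time n B : nat :=
  (20 + B.+1 * 20
   + (loop_free_time unit_prog
   + (for_time n (3 + (for_time n (loop_free_time rank_body) 2 + 5)) 2
   + (running_sums_time n 4 2
   + (for_time n.+1 (4 + for_time B.+1 (loop_free_time round_body) 4) 4
   + (6 + for_time n (loop_free_time price_body) 2
   + (strides_time n + (dp_time n B + walk_time n))))))))%N.

Lemma main_time_bound :
  big_O main_time (fun n B => n * (n * (n * (B.+1 * 1))))%N.
Proof.
have n3 n (B : nat) : (0 < n)%N -> (n < 3 * n)%N by lia.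
have n3' n (B : nat) : (0 < n)%N -> (n.+1 < 3 * n)%N by lia.
have b3 n B : (0 < n)%N -> (B.+1 < 3 * B.+1)%N by lia.
have lin T ce : big_O T (fun _ _ => 1%N) ->
    big_O (fun n B => for_time n (T n B) ce) (fun n B => n * 1)%N.
  exact: (@big_O_for (fun n _ => n) (fun n _ => n) T (fun _ _ => 1%N) ce
    n3 (fun _ _ _ => isT)).
have lin' T ce : big_O T (fun _ _ => 1%N) ->
    big_O (fun n B => for_time n.+1 (T n B) ce) (fun n B => n * 1)%N.
  exact: (@big_O_for (fun n _ => n.+1) (fun n _ => n) T (fun _ _ => 1%N) ce
    n3' (fun _ _ _ => isT)).
have linB T ce : big_O T (fun _ _ => 1%N) ->
    big_O (fun n B => for_time B.+1 (T n B) ce) (fun n B => B.+1 * 1)%N.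
  exact: (@big_O_for (fun _ B => B.+1) (fun _ B => B.+1) T (fun _ _ => 1%N) ce
    b3 (fun _ _ _ => isT)).
have C c W : (forall n B, (0 < n)%N -> (0 < W n B)%N) -> big_O (fun _ _ => c) W.
  by move=> W0; apply: big_O_le W0 (big_O_const c).
have W0 n B : (0 < n)%N -> (0 < n * (n * (n * (B.+1 * 1))))%N.
  by move=> n0; rewrite !muln_gt0 n0.
have acc ce cN : big_O (fun n B => running_sums_time n ce cN)
    (fun n B => n * (n * (n * (B.+1 * 1))))%N.
  apply: big_O_add; first exact: C.
  by apply: big_O_le (lin _ _ (big_O_const _)) => n B n0; nia.
have acc' ce cN : big_O (fun n B => running_sums_time n.+1 ce cN)
    (fun n B => n * (n * (n * (B.+1 * 1))))%N.
  apply: big_O_add; first exact: C.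
  by apply: big_O_le (lin' _ _ (big_O_const _)) => n B n0; nia.
apply: big_O_add.
  by exists 40%N => n B n0; nia.
apply: big_O_add; first exact: C.
apply: big_O_add.
  apply: (@big_O_le _ (fun n B => n * (n * 1))%N).
    by move=> n B n0; rewrite !leq_mul2l !muln_gt0 n0 !orbT.
  apply: (@big_O_for (fun n _ => n) (fun n _ => n) _ _ _ n3); first by lia.
  apply: big_O_add; first by apply: C; lia.
  apply: big_O_add; last by apply: C; lia.
  exact: lin (big_O_const _).
apply: big_O_add; first exact: acc.
apply: big_O_add.
  apply: (@big_O_le _ (fun n B => n * (B.+1 * 1))%N).
    by move=> n B n0; rewrite leq_mul2l mulnA leq_pmull ?orbT // muln_gt0 n0.
  apply: (@big_O_for (fun n _ => n.+1) (fun n _ => n) _ _ _ n3') => //.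
  apply: big_O_add; first exact: C.
  exact: linB (big_O_const _).
apply: big_O_add.
  apply: big_O_add; first exact: C.
  by apply: big_O_le (lin _ _ (big_O_const _)) => n B n0; nia.
apply: big_O_add.
  by apply: big_O_add => //; apply: big_O_add.
apply: big_O_add.
  apply: (@big_O_for (fun n _ => n) (fun n _ => n) _ _ _ n3) => //.
    by move=> n B n0; rewrite !muln_gt0 n0.
  apply: (@big_O_for (fun n _ => n.+1) (fun n _ => n) _ _ _ n3') => //.
    by move=> n B n0; rewrite !muln_gt0 n0.
  apply: (@big_O_for (fun n _ => n.+1) (fun n _ => n) _ _ _ n3') => //.
  exact: linB (big_O_const _).
apply: big_O_add; first exact: C.
have [K1 h1] : big_O (fun n _ => for_time n (loop_free_time fill_body) 2)
    (fun n _ => n * 1)%N by apply: lin (big_O_const _).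
rewrite /step_time; move: (bcost _) (bcost _) (loop_free_time walk_leaf)
  (loop_free_time next_level) => c1 c2 c3 c4.
exists (3 * (c1 + c2 + c3 + c4 + K1 + 3))%N => n B n0.
have := h1 n B n0; set t := for_time _ _ _ => ht.
apply: (@leq_trans ((3 * n) * ((c1 + c2 + c3 + c4 + K1 + 3) * n)))%N.
  by apply: leq_mul; nia.
have : (n * n <= n * (n * (n * (B.+1 * 1))))%N by nia.
by move: (n * (n * (n * _)))%N => W; nia.
Qed.

Lemma nth_enum_map n (f : 'I_n -> nat) (c : 'I_n) :
  nth 0%N [seq f c | c <- enum 'I_n] c = f c.
Proof. by rewrite (nth_map c) ?size_enum_ord // nth_ord_enum. Qed.

Lemma wp_main (R : realType) n (f : 'I_n -> nat) (bs : scheme R) (L eps : R)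
    (n0 : (0 < n)%N) t0 : 0 < eps ->
  let B := (Num.truncn (n%:R / eps) + n)%N in
  let sg := by_freq f (Ordinal n0) in
  let S v := (\sum_(k < v) f (sg k))%N in
  let r v := round_up (eps * L / n%:R) B (S v)%:R in
  let g := level_price bs in
  wp main_prog (main_time n B)
    (fun s' => (0 < (dp n S r g n.-1 n 1 B).1)%N ->
       output s' (nth t0 (dp_forest sg S r g n.-1 n 1 B) 0))
    (input f bs L eps).
Proof.
move=> eps0 B sg S r g; set s0 := input f bs L eps.
have hn : nmem s0 0 0 = n by [].
have hf (c : 'I_n) : nmem s0 1 c = f c by apply: nth_enum_map.
apply: wp_seq (wp_conseq (wp_budget hn (erefl : rmem s0 0 1 = eps) eps0) _ _) _.
- by rewrite leq_add2l leq_mul2r ltnS leq_addr orbT.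
- by move=> s' _ h; exact: h.
rewrite -/B => s1 ag1 hB.
apply: wp_seq (@wp_run _ unit_prog (fun s' => rmem s' 10 0 = eps * L / n%:R) _ isT _) _.
  by rewrite /= /upd /=; trace_back.
move=> s2 ag2 hd.
apply: wp_seq (@wp_sort _ _ n f _ _) _.
- by trace_back.
- by move=> c; trace_back; apply: hf.
move=> s3 ag3 hrk.
have hsg k : (k < n)%N -> nmem s3 11 k = sg k.
  by move=> kn; rewrite -{1}(rank_by_freq f (Ordinal n0) kn) hrk.
apply: wp_seq (@wp_sums _ _ n f sg _ _ hsg) _.
- by trace_back.
- by move=> c; trace_back; apply: hf.
rewrite -/S => s4 ag4 hS.
apply: wp_seq (@wp_round _ _ n B (eps * L / n%:R) S _ _ _ hS) _.
- by trace_back.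
- by trace_back.
- by trace_back.
move=> s5 ag5 hr.
apply: wp_seq (@wp_price _ _ n bs _ _ _) _.
- by trace_back.
- by move=> h; trace_back.
- by move=> h; trace_back.
move=> s6 ag6 hg.
have hn6 : nmem s6 0 0 = n.
  by trace_back.
have hB6 : nmem s6 10 0 = B.
  by trace_back.
apply: wp_seq (wp_strides hn6 hB6) _ => s7 ag7 hst.
have es7 : env n B S r g s7.
  split=> //.
  - by trace_back.
  - by trace_back.
  - by move=> v vn; trace_back; apply: hS.
  - by move=> v vn; trace_back; apply: hr.
  - by move=> d dn; trace_back; apply: hg.
apply: wp_seq (wp_dp es7) _ => s8 ag8 ok.
apply: wp_walk => //.
- by apply: env_agree ag8 _ _ es7.
- by move=> k kn; trace_back; apply: hsg.
Qed.

(** The budget never falls below [n], whence [Num.min 1 eps]: for [eps <= 1] the bound is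
    [n^4 / eps]. Program and constant are fixed before the real field and the input. *)
Theorem theorem2 :
  exists (P : cmd) (K : nat),
  forall (R : realType) (n : nat) (freq : 'I_n -> nat) (bs : scheme R)
    (L eps : R),
    (0 < n)%N -> valid_scheme bs -> long_enough 'I_n bs -> 0 < eps ->
    exists (t : nat) (s : state R),
      [/\ exec P (input freq bs L eps) t s,
          t%:R <= K%:R * (n%:R ^+ 4 / Num.min 1 eps) :> R
        & (exists T0 : btree 'I_n, admissible freq L T0) ->
          exists (T : btree 'I_n) (dopt : R),
            [/\ output s T,
                prefix_tree T,
                (len freq T)%:R <= (1 + eps) * L,
                is_DOPT freq bs L dopt
              & decode_time freq bs T <= dopt] ].
Proof.
have [K hK] := main_time_bound.
exists main_prog, (K * 3)%N => R n f bs L eps n0 vbs _ eps0.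
have [t [s [ex tT out]]] := wp_main f bs L n0 (Leaf (Ordinal n0)) eps0.
exists t, s; split=> //; last first.
  move=> exT0; have [feas /(_ (Leaf (Ordinal n0)))] := dp_approx n0 vbs eps0 exT0.
  set T := nth _ _ _ => -[dopt [h1 h2 h3 h4]].
  by exists T, dopt; split=> //; apply: out.
set B := (Num.truncn (n%:R / eps) + n)%N in tT.
set m := Num.min 1 eps.
have m0 : 0 < m by rewrite lt_min ltr01.
have nR : 1 <= n%:R :> R by rewrite ler1n.
have iv : eps^-1 <= m^-1 by rewrite lef_pV2 ?posrE // ge_min lexx orbT.
have iv1 : 1 <= m^-1 by rewrite invf_ge1 // ge_min lexx.
(* Each of the three summands [floor(n/eps)], [n] and 1 is at most [n / m]; this is the 3 in the
   constant. *)
have bB : B.+1%:R <= 3 * (n%:R / m) :> R.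
  have t1 : (Num.truncn (n%:R / eps))%:R <= n%:R / eps :> R.
    by rewrite truncn_le divr_ge0 // ltW.
  have t2 : n%:R / eps <= n%:R / m :> R by rewrite ler_wpM2l.
  have t3 : n%:R <= n%:R / m :> R by rewrite -{1}[n%:R]mulr1 ler_wpM2l.
  by rewrite /B -addn1 !natrD; lra.
apply: (@le_trans _ _ (K * (n * (n * (n * (B.+1 * 1)))))%:R).
  by rewrite ler_nat; apply: leq_trans tT (hK n B n0).
rewrite !natrM mulr1 -mulrA ler_wpM2l //.
apply: (@le_trans _ _ (n%:R * (n%:R * (n%:R * (3 * (n%:R / m)))))).
  by rewrite !ler_wpM2l.
rewrite le_eqVlt; apply/orP; left; apply/eqP; ring.
Qed.
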